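(* Let $n\ge 1$. The following problem is decidable: given a finite grid pattern $g\in G_n^*$ and a word $w\in W_n$, decide whether $g$ is an SCA representation of the braid $[w]\in B_n$.
   Context: **Braids.** $W_n$ is the set of finite words in the symbols $\sigma_1^{\pm1},\dots,\sigma_{n-1}^{\pm1}$ ($1$ is the empty word). The braid group $B_n$ is the quotient of $W_n$ by the relations $\sigma_i\sigma_i^{-1}=\sigma_i^{-1}\sigma_i=1$, $\sigma_i\sigma_j=\sigma_j\sigma_i$ for $|i-j|>1$, and $\sigma_i\sigma_{i+1}\sigma_i=\sigma_{i+1}\sigma_i\sigma_{i+1}$; $[w]$ is the class of $w$. **Cells.** A cell occupies two adjacent integer positions $(j,j+1)$ and is in one of eight states: $[N_j,N_{j+1}]$ (empty); $[s_j^{(i)},N_{j+1}]$, $[N_j,s_{j+1}^{(i)}]$, $[r_j^{(i)},N_{j+1}]$, $[N_j,l_{j+1}^{(i)}]$ (one strand); $[s_j^{(t)},s_{j+1}^{(t+1)}]$ (two straight strands); $[r_j^{(t)},l_{j+1}^{(t+1)}]$ (crossing of kind $T_1$, strand $t$ over strand $t+1$); $\overline{[r_j^{(t)},l_{j+1}^{(t+1)}]}$ (crossing of kind $T_2$, strand $t+1$ over strand $t$). Superscripts are strand numbers and the subscript is the position at which the strand enters. A strand marked $s$ (straight) leaves at the position where it enters, $r$ goes from $j$ to $j+1$, and $l$ goes from $j+1$ to $j$; strands marked $r$ or $l$ are said to turn. **Grid patterns.** An $n$-strand generation is a row of cells tiling the integer positions, all left positions having the same parity, containing exactly $n$ strands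 numbered $1,\dots,n$ from left to right; it is written $C_0C_1\cdots C_w$, where $C_0$ contains strand $1$ and $C_w$ contains strand $n$ (all cells outside are empty). A grid pattern on $n$ strands is a finite or infinite list of $n$-strand generations (drawn upwards); $G_n$ is the set of these and $G_n^*$ the set of finite ones (including the empty list $[\,]$). **Continuity and rules.** For adjacent cells $A$ at $(j,j+1)$, $B$ at $(j+2,j+3)$ of a generation, their child is the cell at $(j+1,j+2)$ of the next generation. $A$ sends a strand to the child if a strand leaves $A$ at $j+1$; $B$ does if a strand leaves $B$ at $j+2$. A grid pattern is continuous if the cells of each non-first generation are the children of adjacent pairs of the previous one and, for every adjacent pair $A,B$ (empty cells included) of a non-last generation, the left (right) position of the child is occupied iff $A$ (respectively $B$) sends a strand to it. A turning rule is a function $\tau:\{S,T,N\}^2\to\{S,T\}$ (the value at $(N,N)$ being irrelevant); it is a turning rule of a continuous pattern if for each adjacent pair $A,B$ with nonempty child the strands of the child are straight when $\tau(a,b)=S$ and all turn when $\tau(a,b)=T$, where $a$ (resp. $b$) is $N$, $S$ or $T$ according as $A$ (resp. $B$) sends no strand, a straight strand, or a turning strand to the child. A crossing rule is a function $\kappa:\{T_1,T_2,0\}^2\to\{T_1,T_2\}$; it is a crossing rule of the pattern if each child that is a crossing has kind $\kappa(a',b')$, where $a'$ (resp. $b'$) is the kind of crossing in $A$ (resp. $B$), or $0$ if there is none. An SCA pattern is a continuous grid pattern having at least one turning rule and at least one crossing rule; $S_n\subseteq G_n$ and $S_n^*\subseteq G_n^*$ are the sets of SCA patterns. **Representations.**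 $\psi:G_n^*\to W_n$ reads the cells of $g$ generation by generation (first to last) and left to right within a generation, replacing $[r_j^{(t)},l_{j+1}^{(t+1)}]$ by $\sigma_t$, $\overline{[r_j^{(t)},l_{j+1}^{(t+1)}]}$ by $\sigma_t^{-1}$, and every other cell by the empty word; $\varphi(g)=[\psi(g)]\in B_n$. An SCA representation of $b\in B_n$ is a $g\in S_n^*$ with $\varphi(g)=b$. Grid patterns and words are encoded as finite strings in any standard way. *)

(* Defs.v *)
From HB Require Import structures.
From mathcomp Require Import all_boot all_order all_algebra.

Set Implicit Arguments.
Unset Strict Implicit.
Unset Printing Implicit Defensive.

(* All indices are shifted by one: k : 'I_n is strand number k + 1 and      *)
(* t : 'I_n.-1 stands for the generator sigma_(t+1), or for the pair of       *)
(* strands numbered t + 1 and t + 2.                                          *)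

(* (t, true) is sigma_(t+1) and (t, false) is its formal inverse. *)
Definition letter (n : nat) := ('I_n.-1 * bool)%type.
Definition word (n : nat) := seq (letter n).

(* The congruence on words whose quotient is the braid group B_n:             *)
(* [u] = [v] in B_n is braid_eq u v.                                          *)
Inductive braid_eq (n : nat) : word n -> word n -> Prop :=
| braid_refl u : braid_eq u u
| braid_sym u v : braid_eq u v -> braid_eq v u
| braid_trans u v w : braid_eq u v -> braid_eq v w -> braid_eq u w
| braid_cat u u' v v' :
    braid_eq u u' -> braid_eq v v' -> braid_eq (u ++ v) (u' ++ v')
| braid_inv (t : 'I_n.-1) e : braid_eq [:: (t, e); (t, ~~ e)] [::]
| braid_far (s t : 'I_n.-1) : (s.+1 < t) || (t.+1 < s) ->
    braid_eq [:: (s, true); (t, true)] [:: (t, true); (s, true)]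
| braid_near (s t : 'I_n.-1) : t = s.+1 :> nat ->
    braid_eq [:: (s, true); (t, true); (s, true)]
             [:: (t, true); (s, true); (t, true)].

Inductive motion := Straight | Turning.
Inductive kind := T1 | T2.

(* In [RL t] (kind T1) the strand entering on the left passes over, in        *)
(* [RLbar t] (kind T2) the one entering on the right.                         *)
Inductive cell (n : nat) :=
| NN | SN of 'I_n | NS of 'I_n | RN of 'I_n | NL of 'I_n
| SS of 'I_n.-1 | RL of 'I_n.-1 | RLbar of 'I_n.-1.
Arguments NN {n}.

Section Cell.
Variable n : nat.
Implicit Type c : cell n.

Definition strands c : seq nat :=
  match c with
  | NN => [::]
  | SN i | NS i | RN i | NL i => [:: val i]
  | SS t | RL t | RLbar t => [:: val t; t.+1]
  end.

(* The common motion of the strands of a cell, None if the cell is empty. *)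
Definition cell_motion c : option motion :=
  match c with
  | NN => None
  | SN _ | NS _ | SS _ => Some Straight
  | RN _ | NL _ | RL _ | RLbar _ => Some Turning
  end.

Definition cell_kind c : option kind :=
  match c with RL _ => Some T1 | RLbar _ => Some T2 | _ => None end.

Definition left_occupied c : bool :=
  match c with NN | NS _ | NL _ => false | _ => true end.

Definition right_occupied c : bool :=
  match c with NN | SN _ | RN _ => false | _ => true end.

(* The motion of the strand, if any, that leaves a cell at its left position. *)
Definition left_exit c : option motion :=
  match c with
  | SN _ | SS _ => Some Straight
  | NL _ | RL _ | RLbar _ => Some Turning
  | NN | NS _ | RN _ => None
  end.

Definition right_exit c : option motion :=
  match c with
  | NS _ | SS _ => Some Straight
  | RN _ | RL _ | RLbar _ => Some Turning
  | NN | SN _ | NL _ => None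
  end.

Definition psi_cell c : word n :=
  match c with
  | RL t => [:: (t, true)]
  | RLbar t => [:: (t, false)]
  | _ => [::]
  end.

End Cell.

(* The generation C_0 C_1 ... C_w, where C_0 has left position [pos]; strands *)
(* are numbered 1, ..., n from left to right, C_0 contains the first and C_w  *)
(* the last.                                                                  *)
Record generation (n : nat) := Generation {
  pos : int;
  cells : seq (cell n);
  generationP : [&& flatten (map (@strands n) cells) == iota 0 n,
                    0 \in strands (head NN cells)
                  & n.-1 \in strands (last NN cells)] }.

(* G_n^*, the finite patterns. *)
Definition grid_pattern (n : nat) := seq (generation n).

Definition is_left_pos n (G : generation n) (j : int) : bool :=
  (2 %| (j - pos G)%R)%Z.

(* Only meaningful when [is_left_pos G j]; empty outside C_0 ... C_w. *)
Definition cell_at n (G : generation n) (j : int) : cell n :=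
  if (pos G <= j)%R then nth NN (cells G) `|(j - pos G)%R|%N./2 else NN.

Definition consecutive n (g : grid_pattern n) (G H : generation n) : Prop :=
  exists g1 g2, g = g1 ++ [:: G, H & g2].

(* C is the child of the adjacent cells A and B of a non-last generation. *)
Definition child n (g : grid_pattern n) (A B C : cell n) : Prop :=
  exists G H j, [/\ consecutive g G H, is_left_pos G j,
    A = cell_at G j, B = cell_at G (j + 2)%R & C = cell_at H (j + 1)%R].

Definition continuous_pattern n (g : grid_pattern n) : Prop :=
  (forall G H, consecutive g G H -> is_left_pos H (pos G + 1)%R) /\
  (forall A B C, child g A B C ->
     left_occupied C = isSome (right_exit A) /\
     right_occupied C = isSome (left_exit B)).

(* {S, T, N} and {T_1, T_2, 0} are option motion and option kind. *)
Definition turning_rule n (g : grid_pattern n)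
    (tau : option motion * option motion -> motion) : Prop :=
  forall A B C m, child g A B C -> cell_motion C = Some m ->
    m = tau (right_exit A, left_exit B).

Definition crossing_rule n (g : grid_pattern n)
    (kappa : option kind * option kind -> kind) : Prop :=
  forall A B C k, child g A B C -> cell_kind C = Some k ->
    k = kappa (cell_kind A, cell_kind B).

Definition SCA_pattern n (g : grid_pattern n) : Prop :=
  [/\ continuous_pattern g, exists tau, turning_rule g tau
    & exists kappa, crossing_rule g kappa].

Definition psi n (g : grid_pattern n) : word n :=
  flatten [seq flatten (map (@psi_cell n) (cells G)) | G <- g].

(* g is an SCA representation of the braid [w]. *)
Definition SCA_representation n (g : grid_pattern n) (w : word n) : Prop :=
  SCA_pattern g /\ braid_eq (psi g) w.

(* Kleene's general recursive functions: the least class of total functions   *)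
(* on natural numbers that contains zero, successor and the projections and   *)
(* is closed under composition, primitive recursion and regular minimization. *)
Inductive recursive : forall k, (k.-tuple nat -> nat) -> Prop :=
| recursive_zero : recursive (fun _ : 0.-tuple nat => 0)
| recursive_succ : recursive (fun x : 1.-tuple nat => (thead x).+1)
| recursive_proj k (i : 'I_k) : recursive (fun x : k.-tuple nat => tnth x i)
| recursive_comp k m (f : m.-tuple nat -> nat) (g : 'I_m -> k.-tuple nat -> nat) :
    recursive f -> (forall i, recursive (g i)) ->
    recursive (fun x => f [tuple g i x | i < m])
| recursive_prec k (f : k.-tuple nat -> nat) (g : k.+2.-tuple nat -> nat)
    (h : k.+1.-tuple nat -> nat) :
    recursive f -> recursive g ->
    (forall x : k.-tuple nat, h [tuple of 0 :: x] = f x) ->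
    (forall (x : k.-tuple nat) y,
       h [tuple of y.+1 :: x] = g [tuple of y :: h [tuple of y :: x] :: x]) ->
    recursive h
| recursive_min k (f : k.+1.-tuple nat -> nat) (h : k.-tuple nat -> nat) :
    recursive f ->
    (forall x : k.-tuple nat, f [tuple of h x :: x] = 0) ->
    (forall (x : k.-tuple nat) y, y < h x -> f [tuple of y :: x] <> 0) ->
    recursive h
| recursive_ext k (f g : k.-tuple nat -> nat) :
    f =1 g -> recursive f -> recursive g.

(* The problem P, whose instances x : X are given by their codes, has a       *)
(* recursive decision procedure.                                              *)
Definition decidable_problem (X : Type) k (code : X -> k.-tuple nat)
    (P : X -> Prop) : Prop :=
  exists2 f : k.-tuple nat -> nat, recursive f &
    forall x, (P x -> f (code x) = 1) /\ (~ P x -> f (code x) = 0).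

(* Instances are encoded by means of the bijection CodeSeq.code between       *)
(* finite sequences of natural numbers and natural numbers.                   *)
Definition code_letter n (a : letter n) : nat :=
  CodeSeq.code [:: val a.1; nat_of_bool a.2].

Definition code_word n (w : word n) : nat :=
  CodeSeq.code (map (@code_letter n) w).

Definition code_cell n (c : cell n) : nat :=
  CodeSeq.code
    match c with
    | NN => [::]
    | SN i => [:: 0; val i]
    | NS i => [:: 1; val i]
    | RN i => [:: 2; val i]
    | NL i => [:: 3; val i]
    | SS t => [:: 4; val t]
    | RL t => [:: 5; val t]
    | RLbar t => [:: 6; val t]
    end.

Definition code_int (z : int) : nat :=
  CodeSeq.code match z with Posz m => [:: 0; m] | Negz m => [:: 1; m] end.

Definition code_generation n (G : generation n) : nat :=
  CodeSeq.code (code_int (pos G) :: map (@code_cell n) (cells G)).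

Definition code_pattern n (g : grid_pattern n) : nat :=
  CodeSeq.code (map (@code_generation n) g).

Definition code_instance n (x : grid_pattern n * word n) : 2.-tuple nat :=
  [tuple code_pattern x.1; code_word x.2].

Lemma code_instance_inj n : injective (@code_instance n).
Proof.
have cI : injective CodeSeq.code := can_inj CodeSeq.codeK.
have letterI : injective (@code_letter n).
  by move=> [s a] [t b] /cI [/val_inj -> E]; congr (_, _); case: a b E => [] [].
have cellI : injective (@code_cell n).
  by case=> [|i|i|i|i|i|i|i] [|j|j|j|j|j|j|j] /cI //= [/val_inj ->].
have intI : injective code_int by case=> a [] b /cI //= [->].
have genI : injective (@code_generation n).
  case=> [p s P] [q t Q] /cI /= [/intI Epq /(inj_map cellI) Est].
  by case: _ / Epq; case: _ / Est Q => Q; rewrite (bool_irrelevance P Q).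
move=> [g w] [h v] /(congr1 val) /= [/cI /(inj_map genI) -> /cI].
by move/(inj_map letterI) => ->.
Qed.

(* Main.v *)
Require Import Defs.
From Stdlib Require Import Setoid Morphisms Classical.
From HB Require Import structures.
From mathcomp Require Import all_boot all_order all_algebra.
From mathcomp Require Import zify.

Set Implicit Arguments.
Unset Strict Implicit.
Unset Printing Implicit Defensive.

(** An instance (g, w) is accepted when two independent tests succeed: g is an
SCA pattern, and the word read off g is equal to w in the braid group.

The second test is the word problem of B_n, solved with Garside's monoid.
Positive words, taken modulo far commutation and the braid relation, form a
monoid in which a common multiple sigma_i a = sigma_j b of two generators is
always a multiple of their least common multiple, by one and the same element
whether it is read off a or off b ([posequiv_diamond]).  For i = j this says
that the monoid is left cancellative ([posequiv_catI]).
The full twist D = (sigma_1 ... sigma_(n-1))^n is central and divisible by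
every generator, so each braid is a fraction u+ / D^k with u+ positive, and
cancellation gives: u = v in B_n if and only if u+ D^l and v+ D^k are equal in
the monoid ([braid_eqE]).  The defining relations of the monoid keep the length
and the set of letters of a word; the class of a positive word is therefore
finite, and it is exhausted after as many rounds of rewriting as there are
words of that length ([expand_sound], [expand_complete]).

For the first test, the conditions on g, apart from the parity of the positions
in consecutive generations, only involve the set of triples (A, B, C) of cells
such that C occurs in g as the child of A and B.  For fixed n there are
finitely many triples.  A triple with a nonempty cell can only occur within the
extent of two consecutive generations, so its occurrence is decided by a
bounded search, and the empty triple satisfies every condition.  Whether a
given set of triples is continuous and admits a turning rule and a crossing
rule is then a finite table ([decide_finite]), with no search for the rules.

It remains to see that these procedures are recursive.  A natural number codes
a list of natural numbers, by 2^a (2b + 1) for the list with head a and tail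
coded by b.  Head, tail and cons are recursive, so the functions between coded
types that act recursively on codes ([computable]) are closed under iteration
and folding over lists ([comp_iter], [comp_foldl]), and the tests above are
compositions of such operations. *)

(** * Positive braid words *)

Definition far (i j : nat) := (i.+1 < j) || (j.+1 < i).
Definition near (i j : nat) := (j == i.+1) || (i == j.+1).

(** A rewriting step is given by a list, and not only as a relation, because the
decision procedure has to compute this list.  The congruence [posequiv] that
it generates defines the positive braid monoid. *)
Fixpoint rewrites (w : seq nat) : seq (seq nat) :=
  if w is i :: u then
    (if u is j :: v then if far i j then [:: j :: i :: v] else [::] else [::])
    ++ (if u is [:: j, k & v] then
          if near i j && (k == i) then [:: [:: j, i, j & v]] else [::]
        else [::])
    ++ map (cons i) (rewrites u)
  else [::].

Inductive posequiv : seq nat -> seq nat -> Prop :=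
| posequiv_refl u : posequiv u u
| posequiv_step u v w : v \in rewrites u -> posequiv v w -> posequiv u w.

Lemma farC i j : far i j = far j i. Proof. by rewrite /far orbC. Qed.
Lemma nearC i j : near i j = near j i. Proof. by rewrite /near orbC. Qed.

Variant rewrites_spec i u : seq nat -> Prop :=
| RewritesFar j v of far i j & u = j :: v : rewrites_spec i u [:: j, i & v]
| RewritesNear j v of near i j & u = [:: j, i & v] :
    rewrites_spec i u [:: j, i, j & v]
| RewritesTail v of v \in rewrites u : rewrites_spec i u (i :: v).

Lemma rewrites_consP i u v : v \in rewrites (i :: u) -> rewrites_spec i u v.
Proof.
rewrite /= !mem_cat => /or3P[].
- case: u => // j u; case: ifP => // fij; rewrite inE => /eqP ->.
  exact: RewritesFar.
- case: u => // j [|k u] //; case: ifP => // /andP[nij /eqP ->].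
  by rewrite inE => /eqP ->; apply: RewritesNear.
- by case/mapP=> x xu ->; apply: RewritesTail.
Qed.

Lemma far_rewrites i j w : far i j -> [:: j, i & w] \in rewrites [:: i, j & w].
Proof. by move=> /= ->; rewrite mem_cat mem_head. Qed.

Lemma near_rewrites i j w :
  near i j -> [:: j, i, j & w] \in rewrites [:: i, j, i & w].
Proof. by move=> /= ->; rewrite eqxx !mem_cat mem_head orbT. Qed.

Lemma cons_rewrites i u v : v \in rewrites u -> i :: v \in rewrites (i :: u).
Proof. by move=> uv; rewrite /= !mem_cat map_f ?orbT. Qed.

Lemma rewrites_sym u v : v \in rewrites u -> u \in rewrites v.
Proof.
elim: u v => // i u IH v /rewrites_consP[j w fij ->|j w nij ->|w uw].
- by apply: far_rewrites; rewrite farC.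
- by apply: near_rewrites; rewrite nearC.
- exact/cons_rewrites/IH.
Qed.

Lemma rewrites_cat u v x y :
  v \in rewrites u -> x ++ v ++ y \in rewrites (x ++ u ++ y).
Proof.
move=> uv; elim: x => [|i x IH] /=; last exact: cons_rewrites.
elim: u v uv => // i u IH v /rewrites_consP[j w fij ->|j w nij ->|w uw] /=.
- exact: far_rewrites.
- exact: near_rewrites.
- exact/cons_rewrites/IH.
Qed.

#[local] Hint Resolve posequiv_refl : core.

Lemma posequiv_trans v u w : posequiv u v -> posequiv v w -> posequiv u w.
Proof. by elim=> // x y z xy _ IH /IH; apply: posequiv_step. Qed.

Lemma posequiv_sym u v : posequiv u v -> posequiv v u.
Proof.
elim=> [w|x y z xy _ IH]; first exact: posequiv_refl.
by apply: posequiv_trans IH _; apply: posequiv_step (rewrites_sym xy) (posequiv_refl _).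
Qed.

Lemma posequiv_context x y u v : posequiv u v -> posequiv (x ++ u ++ y) (x ++ v ++ y).
Proof.
elim=> [w|a b c ab _]; first exact: posequiv_refl.
exact/posequiv_step/rewrites_cat.
Qed.

Lemma posequiv_cat u u' v v' :
  posequiv u u' -> posequiv v v' -> posequiv (u ++ v) (u' ++ v').
Proof.
move=> uu' vv'; apply: (@posequiv_trans (u' ++ v)); first exact: (@posequiv_context [::]).
by have := posequiv_context u' [::] vv'; rewrite !cats0.
Qed.

#[global] Instance posequiv_Equivalence : Equivalence posequiv.
Proof.
constructor.
- exact: posequiv_refl.
- exact: posequiv_sym.
- by move=> u v w; apply: posequiv_trans.
Qed.

#[global] Instance cons_posequiv : Proper (eq ==> posequiv ==> posequiv) (@cons nat).
Proof.
move=> i _ <- u v uv.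
by apply: (@posequiv_cat [:: i] [:: i]) => //; apply: posequiv_refl.
Qed.

#[global] Instance cat_posequiv : Proper (posequiv ==> posequiv ==> posequiv) (@cat nat).
Proof. by move=> u u' uu' v v'; apply: posequiv_cat. Qed.

Lemma posequiv_far i j w : far i j -> posequiv [:: i, j & w] [:: j, i & w].
Proof. by move=> fij; apply: posequiv_step (far_rewrites w fij) (posequiv_refl _). Qed.

Lemma posequiv_near i j w : near i j -> posequiv [:: i, j, i & w] [:: j, i, j & w].
Proof. by move=> nij; apply: posequiv_step (near_rewrites w nij) (posequiv_refl _). Qed.

Lemma rewrites_all (p : pred nat) u v : v \in rewrites u -> all p v = all p u.
Proof.
elim: u v => // i u IH v /rewrites_consP[j w _ ->|j w _ ->|w uw] /=.
- by rewrite andbCA.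
- by case: (p i); case: (p j).
- by rewrite (IH w).
Qed.

Lemma posequiv_all (p : pred nat) u v : posequiv u v -> all p u = all p v.
Proof. by elim=> // x y z /rewrites_all ->. Qed.

Lemma rewrites_size u v : v \in rewrites u -> size v = size u.
Proof.
elim: u v => // i u IH v /rewrites_consP[j w _ ->|j w _ ->|w uw] //=.
by rewrite (IH w).
Qed.

Lemma posequiv_size u v : posequiv u v -> size u = size v.
Proof. by elim=> // x y z /rewrites_size -> _. Qed.

(** * Cancellation *)

(** sigma_i (complement i j) = sigma_j (complement j i) is the least common
multiple of sigma_i and sigma_j in the positive monoid. *)
Definition complement (i j : nat) : seq nat :=
  if i == j then [::] else if near i j then [:: j; i] else [:: j].

Definition diamond i j a b :=
  exists2 c, posequiv a (complement i j ++ c) & posequiv b (complement j i ++ c).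

Lemma diamond_sym i j a b : diamond i j a b -> diamond j i b a.
Proof. by case=> c ? ?; exists c. Qed.

Lemma diamondE i j a b : diamond i j a b ->
  [\/ i = j /\ posequiv a b,
      near i j /\ exists2 c, posequiv a [:: j, i & c] & posequiv b [:: i, j & c]
    | far i j /\ exists2 c, posequiv a (j :: c) & posequiv b (i :: c)].
Proof.
case=> c; rewrite /complement (eq_sym j) (nearC j).
case: eqP => [-> ac bc|neq]; first by constructor 1; split=> //; rewrite ac bc.
case: ifP => nij ac bc; first by constructor 2; split=> //; exists c.
constructor 3; split; last by exists c.
by move: nij neq; rewrite /near /far; lia.
Qed.

Lemma diamond_eq i a b : posequiv a b -> diamond i i a b.
Proof. by move=> ab; exists b; rewrite /complement eqxx //; exact: posequiv_refl. Qed.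

Lemma diamond_near i j a b c : near i j ->
  posequiv a [:: j, i & c] -> posequiv b [:: i, j & c] -> diamond i j a b.
Proof.
move=> nij ac bc; exists c; rewrite /complement 1?(nearC j) nij;
  by case: eqP nij => //; rewrite /near; lia.
Qed.

Lemma diamond_far i j a b c : far i j ->
  posequiv a (j :: c) -> posequiv b (i :: c) -> diamond i j a b.
Proof.
move=> fij ac bc; exists c; rewrite /complement;
  by case: eqP fij => [->|_]; rewrite /far /near; [lia | case: ifP => //; lia].
Qed.

Definition diamond_upto m := forall i j a b,
  size a < m -> posequiv (i :: a) (j :: b) -> diamond i j a b.

Section Transitivity.
Variable m : nat.
Hypothesis IHm : diamond_upto m.

Lemma upto_eq i a b : size a < m -> posequiv (i :: a) (i :: b) -> posequiv a b.
Proof.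
by move=> am /(IHm am)/diamondE[[]//|[]|[]]; rewrite /near /far; lia.
Qed.

Lemma upto_near i j a b : near i j -> size a < m ->
  posequiv (i :: a) (j :: b) ->
  exists2 c, posequiv a [:: j, i & c] & posequiv b [:: i, j & c].
Proof.
by move=> nij am /(IHm am)/diamondE[[]|[]//|[]]; move: nij; rewrite /near /far; lia.
Qed.

Lemma upto_far i j a b : far i j -> size a < m ->
  posequiv (i :: a) (j :: b) -> exists2 c, posequiv a (j :: c) & posequiv b (i :: c).
Proof.
by move=> nij am /(IHm am)/diamondE[[]|[]|[]//]; move: nij; rewrite /near /far; lia.
Qed.

(** The middle word d is a multiple of both complement k i and complement k j.
Its length is at most m, so the hypothesis on shorter words can be applied to
these two factorizations of d, repeatedly, until they have a common refinement.
What remains is to check, for each relative position of i, j and k, that a and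
b are then multiples of the complements of i and j by the same word, which is
given explicitly in each case. *)
Lemma diamond_trans i k j a d b : size d <= m ->
  diamond i k a d -> diamond k j d b -> diamond i j a b.
Proof.
move=> dm.
(* i and k are adjacent, k and j commute: used again with i and j exchanged *)
have wlog_far a' b' i' j' : near i' k -> far k j' -> size d <= m ->
    diamond i' k a' d -> diamond k j' d b' -> diamond i' j' a' b'.
  move=> nik fkj _ /diamondE[[]|[_ [c1 ac1 dc1]]|[]];
    try by move: nik; rewrite /near /far; lia.
  move=> /diamondE[[]|[]|[_ [c2 dc2 bc2]]]; try by move: fkj; rewrite /near /far; lia.
  have dS := posequiv_size dc1; have dS2 := posequiv_size dc2; rewrite /= in dS dS2.
  have E : posequiv [:: i', k & c1] (j' :: c2) by rewrite -dc1 dc2.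
  have [fij|nij] : far i' j' \/ near i' j'.
    by move: nik fkj; rewrite /near /far; lia.
  - have [|e ke c2e] := upto_far fij _ E; first by rewrite /=; lia.
    have [|f cf ef] := upto_far fkj _ ke; first by lia.
    apply: (diamond_far (c := [:: k, i' & f])) => //.
      by rewrite ac1 cf (@posequiv_far i' j') // (@posequiv_far k j').
    by rewrite bc2 c2e ef (@posequiv_near k i') // nearC.
  - have [|e ke c2e] := upto_near nij _ E; first by rewrite /=; lia.
    have [|f cf ef] := upto_far fkj _ ke; first by lia.
    have cS := posequiv_size cf; have eS := posequiv_size ke; rewrite /= in cS eS.
    have [|g eg fg] := upto_near nik _ ef; first by lia.
    apply: (diamond_near (c := [:: k, i', j' & g])) => //.
      rewrite ac1 cf fg (@posequiv_near i' j') // (@posequiv_far j' k) 1?farC //.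
      by rewrite (@posequiv_far k j' (i' :: _)) // (@posequiv_near k i') // nearC.
    rewrite bc2 c2e eg (@posequiv_far j' k) 1?farC // (@posequiv_near k i') 1?nearC //.
    by rewrite (@posequiv_near i' j') // (@posequiv_far k j').
case=> c1 ac1 dc1 [c2 dc2 bc2].
have P1 : diamond i k a d by exists c1.
have P2 : diamond k j d b by exists c2.
case: (diamondE P1) => [[ik ad]|[nik [{}c1 {}ac1 {}dc1]]|[fik [{}c1 {}ac1 {}dc1]]].
- by rewrite ik; exists c2; rewrite // ad.
- case: (diamondE P2) => [[kj db]|[nkj [{}c2 {}dc2 {}bc2]]|[fkj _]].
  + by rewrite -kj; case: P1 => c ac dc; exists c; rewrite // -db.
  + have dS := posequiv_size dc1; have dS2 := posequiv_size dc2; rewrite /= in dS dS2.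
    have E : posequiv [:: i, k & c1] [:: j, k & c2] by rewrite -dc1 dc2.
    have [ij|fij] : i = j \/ far i j by move: nik nkj; rewrite /near /far; lia.
      subst j; apply: diamond_eq; rewrite ac1 bc2.
      by rewrite (upto_eq _ (upto_eq _ E)) //=; lia.
    have [|e c1e c2e] := upto_far fij _ E; first by rewrite /=; lia.
    have [|f c1f ef] := upto_near nkj _ c1e; first by lia.
    have nki : near k i by rewrite nearC.
    have [|g c2g eg] := upto_near nki _ c2e; first by lia.
    have cS := posequiv_size c1f; have eS := posequiv_size c1e; rewrite /= in cS eS.
    have E2 : posequiv [:: k, j & f] [:: k, i & g] by rewrite -ef.
    have E3 : posequiv (j :: f) (i :: g) by apply: upto_eq E2; rewrite /=; lia.
    have fji : far j i by rewrite farC.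
    have [|h fh gh] := upto_far fji _ E3; first by lia.
    apply: (diamond_far (c := [:: k, j, i, k & h])) => //.
      rewrite ac1 c1f fh (@posequiv_far i j) // (@posequiv_near i k) //.
      by rewrite (@posequiv_near k j).
    rewrite bc2 c2g gh (@posequiv_far j i) 1?farC // (@posequiv_near j k) 1?nearC //.
    by rewrite (@posequiv_near k i) 1?nearC // (@posequiv_far j i) // farC.
  + exact: wlog_far fkj dm P1 P2.
- case: (diamondE P2) => [[kj db]|[nkj _]|[fkj [{}c2 {}dc2 {}bc2]]].
  + by rewrite -kj; case: P1 => c ac dc; exists c; rewrite // -db.
  + apply: diamond_sym; apply: wlog_far dm (diamond_sym P2) (diamond_sym P1).
      by rewrite nearC.
    by rewrite farC.
  + have dS := posequiv_size dc1; rewrite /= in dS.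
    have E : posequiv (i :: c1) (j :: c2) by rewrite -dc1 dc2.
    have {}E : diamond i j c1 c2 by apply: IHm E; lia.
    case/diamondE: E => [[ij c12]|[nij [e c1e c2e]]|[fij [e c1e c2e]]].
    * by subst j; apply: diamond_eq; rewrite ac1 bc2 c12.
    * apply: (diamond_near (c := k :: e)) => //.
        by rewrite ac1 c1e (@posequiv_far k j) // (@posequiv_far k i) // farC.
      by rewrite bc2 c2e (@posequiv_far k i) 1?farC // (@posequiv_far k j).
    * apply: (diamond_far (c := k :: e)) => //.
        by rewrite ac1 c1e (@posequiv_far k j).
      by rewrite bc2 c2e (@posequiv_far k i) 1?farC.
Qed.

End Transitivity.

Lemma rewrites_diamond i j a b : j :: b \in rewrites (i :: a) -> diamond i j a b.
Proof.
move E: (j :: b) => v /rewrites_consP V.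
case: V E => [k w fik ->|k w nik ->|w aw] [-> ->].
- by apply: diamond_far => //; exact: posequiv_refl.
- by apply: diamond_near => //; exact: posequiv_refl.
- by apply/diamond_eq/(posequiv_step aw)/posequiv_refl.
Qed.

(** Garside's lemma, by induction on the length and then on the number of
rewriting steps: cut the chain after its first step, at a word with first
letter k.  The step gives the pair (i, k), the rest of the chain gives the
pair (k, j), and [diamond_trans] combines them using shorter words only. *)
Theorem posequiv_diamond i j a b : posequiv (i :: a) (j :: b) -> diamond i j a b.
Proof.
suff: forall m, diamond_upto m by move/(_ (size a).+1); apply.
elim=> // m IHm {}i {}j {}a {}b am.
move Eu: (i :: a) => u; move Ev: (j :: b) => v uv.
elim: uv i j a b am Eu Ev => {u v} [u|u v w uv _ IH] i j a b am Eu Ev.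
  by move: Ev; rewrite -Eu => -[-> ->]; apply/diamond_eq/posequiv_refl.
have := rewrites_size uv.
case: v uv IH => [|k d] uv IH; rewrite -Eu //= => -[dS].
apply: (@diamond_trans _ IHm i k j a d); first by rewrite dS.
  by apply: rewrites_diamond; rewrite Eu.
by apply: IH; rewrite ?dS.
Qed.

Lemma posequiv_catI u a b : posequiv (u ++ a) (u ++ b) -> posequiv a b.
Proof.
elim: u => //= i u IH /posequiv_diamond[c]; rewrite /complement eqxx => ac bc.
by apply: IH; rewrite ac bc.
Qed.

(** * The full twist *)

(** The Coxeter element: the product of the generators, numbered from 0 to m - 1,
in increasing order.  Its power of exponent m + 1 is the full twist of m + 1
strands. *)
Definition cox (m : nat) : seq nat := iota 0 m.

Fixpoint power (k : nat) (u : seq nat) : seq nat :=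
  if k is k'.+1 then u ++ power k' u else [::].

Lemma powerD k l u : power (k + l) u = power k u ++ power l u.
Proof. by elim: k => //= k ->; rewrite catA. Qed.

Lemma powerSr k u : power k.+1 u = power k u ++ u.
Proof. by rewrite -addn1 powerD /= cats0. Qed.

Definition full_twist m := power m.+1 (cox m).

Arguments cox : simpl never.
Arguments full_twist : simpl never.

Lemma far_cat i u : all (far i) u -> posequiv (i :: u) (rcons u i).
Proof.
elim: u => //= j u IH /andP[fij /IH u_i].
by rewrite (@posequiv_far i j) // u_i.
Qed.

(** Conjugation by the Coxeter element maps sigma_i to sigma_(i+1): the letters
after i + 1 commute with i, those before i commute with i + 1, and the braid
relation does the rest. *)
Lemma cox_shift m i : i.+1 < m -> posequiv (cox m ++ [:: i]) (i.+1 :: cox m).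
Proof.
move=> im; rewrite /cox (_ : m = i + (2 + (m - i.+2))); last by lia.
rewrite !iotaD add0n /= -catA /=.
have -> : posequiv (iota (i + 2) (m - i.+2) ++ [:: i]) (i :: iota (i + 2) (m - i.+2)).
  rewrite cats1; apply/posequiv_sym/far_cat/allP => j; rewrite mem_iota /far; lia.
have -> : posequiv [:: i, i.+1, i & iota (i + 2) (m - i.+2)]
   [:: i.+1, i, i.+1 & iota (i + 2) (m - i.+2)].
  by apply: posequiv_near; rewrite /near eqxx.
rewrite -cat_cons.
have -> : posequiv (i.+1 :: iota 0 i) (iota 0 i ++ [:: i.+1]).
  rewrite cats1; apply/far_cat/allP => j; rewrite mem_iota /far; lia.
by rewrite -catA.
Qed.

Lemma cox_shift_word m u : all (fun i => i.+1 < m) u ->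
  posequiv (cox m ++ u) (map succn u ++ cox m).
Proof.
elim: u => [|i u IH] /=; first by rewrite cats0.
case/andP=> im /IH E; rewrite -cat1s catA cox_shift //=.
by rewrite E.
Qed.

Lemma power_shift m k i : i + k < m ->
  posequiv (power k (cox m) ++ [:: i]) (i + k :: power k (cox m)).
Proof.
elim: k i => [|k IH] i ikm; first by rewrite addn0.
rewrite powerSr -catA cox_shift; last by lia.
rewrite -cat1s catA IH; last by lia.
by rewrite /= addSnnS.
Qed.

(** The last generator is not shifted to another one by the Coxeter element, but
its square takes it to the first: write one factor as cox m followed by the
last generator and slide cox m through the other factor by [cox_shift]. *)
Lemma cox_last m :
  posequiv (cox m.+1 ++ cox m.+1 ++ [:: m]) (0 :: cox m.+1 ++ cox m.+1).
Proof.
have E : posequiv (cox m.+1 ++ cox m) (iota 1 m ++ cox m.+1).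
  rewrite cox_shift_word ?(iotaDl 1 0) //.
  by apply/allP => j; rewrite mem_iota; lia.
have C : cox m.+1 = cox m ++ [:: m] by rewrite /cox -addn1 iotaD.
apply: posequiv_sym; rewrite {2}C catA.
have -> : posequiv (0 :: (cox m.+1 ++ cox m) ++ [:: m])
    (0 :: (iota 1 m ++ cox m.+1) ++ [:: m]).
  by rewrite E.
by rewrite -catA.
Qed.

(** Among the m + 1 factors of the full twist, m - 1 - i shift sigma_i up to the
last generator, two take it to the first, and i shift it back. *)
Lemma full_twist_comm m i : i < m ->
  posequiv (full_twist m ++ [:: i]) (i :: full_twist m).
Proof.
case: m => // m im.
have -> : full_twist m.+1 =
    power i (cox m.+1) ++ (cox m.+1 ++ cox m.+1) ++ power (m - i) (cox m.+1).
  rewrite (_ : cox _ ++ cox _ = power 2 (cox m.+1)); last by rewrite /= cats0.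
  rewrite -!powerD /full_twist; congr power.
  by rewrite addnCA subnKC.
rewrite -!catA power_shift; last by lia.
rewrite subnKC // -[m :: _]cat1s.
rewrite (_ : cox _ ++ cox _ ++ [:: m] ++ _ =
    (cox m.+1 ++ cox m.+1 ++ [:: m]) ++ power (m - i) (cox m.+1));
  last by rewrite -!catA.
rewrite cox_last cat_cons -[0 :: _]cat1s [X in posequiv X]catA power_shift //.
by rewrite add0n -catA.
Qed.

Lemma power_comm k u v :
  posequiv (u ++ v) (v ++ u) -> posequiv (power k u ++ v) (v ++ power k u).
Proof.
move=> uv; elim: k => [|k IH] /=; first by rewrite cats0.
by rewrite -catA IH !catA uv.
Qed.

Lemma full_twist_comm_word m k u : all (fun i => i < m) u ->
  posequiv (power k (full_twist m) ++ u) (u ++ power k (full_twist m)).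
Proof.
move=> um; apply: power_comm.
elim: u um => [|i u IH] /=; first by rewrite cats0.
by case/andP=> im /IH E; rewrite -cat1s catA full_twist_comm // cat_cons E.
Qed.

(** The positive word that plays the role of sigma_i^-1 D. *)
Definition adjoint m i : seq nat :=
  power i (cox m) ++ behead (cox m) ++ power (m - i) (cox m).

(** The Coxeter element starts with sigma_0, and its power of exponent i moves
this letter in front as sigma_i. *)
Lemma adjointE m i : i < m -> posequiv (i :: adjoint m i) (full_twist m).
Proof.
move=> im.
have -> : full_twist m = power i (cox m) ++ cox m ++ power (m - i) (cox m).
  rewrite -[cox m ++ _]/(power (m - i).+1 _) -powerD /full_twist.
  by congr power; lia.
have -> : cox m = 0 :: behead (cox m) by case: m im.
rewrite /adjoint -[X in power _ X ++ X ++ _]/(0 :: behead (cox m)).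
have {1}-> : i = 0 + i by [].
rewrite -cat_cons -power_shift // -catA.
by case: m im.
Qed.

Lemma adjoint_letters m i : all (fun j => j < m) (adjoint m i).
Proof.
have cm : all (fun j => j < m) (cox m) by apply/allP=> j; rewrite mem_iota.
have pm k : all (fun j => j < m) (power k (cox m)).
  by elim: k => //= k IH; rewrite all_cat cm.
by rewrite !all_cat !pm andbT /=; apply/allP => j /mem_behead/(allP cm).
Qed.

Lemma full_twist_letters m : all (fun j => j < m) (full_twist m).
Proof.
have cm : all (fun j => j < m) (cox m) by apply/allP=> j; rewrite mem_iota.
by rewrite /full_twist; elim: m.+1 => //= k IH; rewrite all_cat cm.
Qed.

(** Cancel sigma_i from sigma_i (adjoint) sigma_i = D sigma_i = sigma_i D. *)
Lemma adjointEr m i : i < m -> posequiv (adjoint m i ++ [:: i]) (full_twist m).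
Proof.
move=> im; apply: (@posequiv_catI [:: i]).
by rewrite /= -cat_cons adjointE // full_twist_comm.
Qed.

(** * The word problem of the braid group *)

#[global] Instance braid_eq_Equivalence n : Equivalence (@braid_eq n).
Proof.
constructor.
- exact: braid_refl.
- exact: braid_sym.
- exact: braid_trans.
Qed.

#[global] Instance cat_braid_eq n :
  Proper (@braid_eq n ==> @braid_eq n ==> @braid_eq n) (@cat (letter n)).
Proof. by move=> u u' uu' v v'; apply: braid_cat. Qed.

#[global] Instance cons_braid_eq n :
  Proper (eq ==> @braid_eq n ==> @braid_eq n) (@cons (letter n)).
Proof.
intros a _ <- u v uv.
by apply: (@braid_cat n [:: a] [:: a]) => //; apply: braid_refl.
Qed.

#[local] Hint Resolve braid_refl : core.

Section Fractions.
Variable n : nat.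
Implicit Types (a : letter n) (u v w : word n).

Let D := full_twist n.-1.

(** The fraction numerator u / D^(denominator u) represents the braid [u]: each
sigma_t^-1 is adjoint t / D. *)
Definition numerator_letter a : seq nat :=
  if a.2 then [:: val a.1] else adjoint n.-1 (val a.1).

Definition numerator u : seq nat := flatten (map numerator_letter u).

Definition denominator u : nat := count (fun a => ~~ a.2) u.

Lemma numerator_cat u v : numerator (u ++ v) = numerator u ++ numerator v.
Proof. by rewrite /numerator map_cat flatten_cat. Qed.

Lemma numerator_letters u : all (fun i => i < n.-1) (numerator u).
Proof.
elim: u => //= -[t e] u IH; rewrite /numerator /= all_cat -/(numerator u) IH andbT.
by case: e; [rewrite /= ltn_ord | exact: adjoint_letters].
Qed.

(** Equality of fractions with central denominators. *)
Definition positive_eq u v : Prop :=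
  posequiv (numerator u ++ power (denominator v) D)
           (numerator v ++ power (denominator u) D).

Lemma twist_numerator k u :
  posequiv (power k D ++ numerator u) (numerator u ++ power k D).
Proof. exact/full_twist_comm_word/numerator_letters. Qed.

Lemma twist_power_comm k l : power k D ++ power l D = power l D ++ power k D.
Proof. by rewrite -!powerD addnC. Qed.

(** Multiplying both equations by suitable powers of the full twist leaves the
denominator of v on both sides, where it has to be cancelled. *)
Lemma positive_eq_trans v u w : positive_eq u v -> positive_eq v w -> positive_eq u w.
Proof.
rewrite /positive_eq => uv vw; apply: (@posequiv_catI (power (denominator v) D)).
rewrite !catA !twist_numerator -!catA.
rewrite catA uv -catA (twist_power_comm _ (denominator w)) catA vw.
by rewrite -catA.
Qed.

Lemma positive_eq_cat u u' v v' :
  positive_eq u u' -> positive_eq v v' -> positive_eq (u ++ v) (u' ++ v').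
Proof.
rewrite /positive_eq /denominator !numerator_cat !count_cat -!/(denominator _).
move=> uu' vv'; rewrite !powerD.
have E x y k l : posequiv ((numerator x ++ numerator y) ++ power k D ++ power l D)
    ((numerator x ++ power k D) ++ numerator y ++ power l D).
  by rewrite -!catA; apply: posequiv_cat => //; rewrite !catA twist_numerator.
by rewrite !E uu' vv'.
Qed.

Lemma braid_eq_positive u v : braid_eq u v -> positive_eq u v.
Proof.
elim=> {u v} [u|u v _|u v w _ uv _ vw|u u' v v' _ uu' _ vv'|t e|s t st|s t st].
- by [].
- exact: posequiv_sym.
- exact: positive_eq_trans uv vw.
- exact: positive_eq_cat.
- have tn := ltn_ord t; rewrite /positive_eq /numerator /denominator.
  by case: e; rewrite /= !cats0; [exact: adjointE | exact: adjointEr].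
- by apply: posequiv_far; rewrite /far.
- by apply: posequiv_near; apply/orP; left; apply/eqP.
Qed.

(** Letters that are not generators are dropped; the lemmas below apply this map
to words over the generators only. *)
Definition of_positive (u : seq nat) : word n := [seq (t, true) | t <- pmap insub u].

Lemma of_positive_cat x y : of_positive (x ++ y) = of_positive x ++ of_positive y.
Proof. by rewrite /of_positive pmap_cat map_cat. Qed.

Lemma of_positive_cons i x (im : i < n.-1) :
  of_positive (i :: x) = (Ordinal im, true) :: of_positive x.
Proof.
by rewrite /of_positive /= (insubT (fun i => i < n.-1) im).
Qed.

Lemma rewrites_of_positive x y : y \in rewrites x -> all (fun i => i < n.-1) x ->
  braid_eq (of_positive x) (of_positive y).
Proof.
elim: x y => // i x IH y /rewrites_consP[j w fij ->|j w nij ->|z xz] /=.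
- case/and3P=> im jm _.
  rewrite -[[:: i, j & w]]/([:: i; j] ++ w) -[[:: j, i & w]]/([:: j; i] ++ w).
  rewrite !of_positive_cat; apply: braid_cat => //.
  by rewrite !of_positive_cons; apply: braid_far.
- case/and4P=> im jm _ _.
  rewrite -[[:: i, j, i & w]]/([:: i; j; i] ++ w) -[[:: j, i, j & w]]/([:: j; i; j] ++ w).
  rewrite !of_positive_cat; apply: braid_cat => //.
  rewrite !of_positive_cons.
  case/orP: nij => /eqP E; first exact: braid_near.
  by apply/braid_sym/braid_near.
- case/andP=> im /(IH _ xz) xz'.
  by rewrite -(cat1s i x) -(cat1s i z) !of_positive_cat xz'.
Qed.

Lemma braid_eq_of_positive x y : posequiv x y -> all (fun i => i < n.-1) x ->
  braid_eq (of_positive x) (of_positive y).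
Proof.
elim=> // {}x z {}y xz _ IH xm; rewrite (rewrites_of_positive xz xm).
by apply: IH; rewrite (rewrites_all _ xz).
Qed.

Definition inverse_word w : word n := rev [seq (a.1, ~~ a.2) | a <- w].

Lemma inverse_wordr w : braid_eq (w ++ inverse_word w) [::].
Proof.
elim: w => //= -[t e] w IH; rewrite /inverse_word /= rev_cons -cats1 -/(inverse_word w).
rewrite -(cat1s _ (w ++ _)) (catA w) IH /=.
exact: braid_inv.
Qed.

Lemma Delta_comm k w :
  braid_eq (of_positive (power k D) ++ w) (w ++ of_positive (power k D)).
Proof.
have C t : braid_eq (of_positive (power k D) ++ [:: (t, true)])
    ([:: (t, true)] ++ of_positive (power k D)).
  have -> : [:: (t, true)] = of_positive [:: val t] by rewrite /of_positive /= valK.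
  rewrite -!of_positive_cat; apply: braid_eq_of_positive.
    by apply: full_twist_comm_word; rewrite /= ltn_ord.
  rewrite all_cat /= ltn_ord andbT; elim: k => //= k IH.
  by rewrite all_cat full_twist_letters.
elim: w => [|[t e] w IH]; first by rewrite cats0.
suff E : braid_eq (of_positive (power k D) ++ [:: (t, e)])
    ([:: (t, e)] ++ of_positive (power k D)).
  by rewrite -cat1s catA E -!catA IH.
case: e; first exact: C.
(* conjugating the commutation with (t, true) by (t, false) *)
have I1 := braid_inv t true; have I2 := braid_inv t false; rewrite /= in I1 I2.
transitivity ([:: (t, false); (t, true)] ++ (of_positive (power k D) ++ [:: (t, false)])).
  by rewrite I2.
rewrite -[[:: (t, false); _]]/([:: (t, false)] ++ [:: (t, true)]) -!catA.
apply: braid_cat => //; rewrite catA -C -catA.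
by rewrite -[[:: (t, true)] ++ _]/[:: (t, true); (t, false)] I1 cats0.
Qed.

Lemma of_numerator_letter a :
  braid_eq (of_positive (numerator_letter a)) (a :: of_positive (power (~~ a.2) D)).
Proof.
have tE (t : 'I_n.-1) : of_positive [:: val t] = [:: (t, true)].
  by rewrite /of_positive /= valK.
case: a => t [] /=; rewrite /numerator_letter /=; first by rewrite tE.
have -> : braid_eq (of_positive (D ++ [::]))
    ([:: (t, true)] ++ of_positive (adjoint n.-1 t)).
  rewrite cats0 -tE -of_positive_cat; apply/braid_sym/braid_eq_of_positive.
    exact/adjointE/ltn_ord.
  by rewrite /= ltn_ord adjoint_letters.
rewrite -cat1s catA.
have I2 : braid_eq ([:: (t, false)] ++ [:: (t, true)]) [::] := braid_inv t false.
by rewrite I2.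
Qed.

Lemma of_numerator u :
  braid_eq (of_positive (numerator u)) (u ++ of_positive (power (denominator u) D)).
Proof.
elim: u => [|a u IH] //; rewrite /numerator /= of_positive_cat -/(numerator u) IH.
rewrite of_numerator_letter powerD of_positive_cat /=; apply: cons_braid_eq => //.
by rewrite !catA Delta_comm.
Qed.

(** From right to left, the two fractions have equal images in the braid group,
and the power of the full twist cancels there because the group has inverses. *)
Theorem braid_eqE u v : braid_eq u v <-> positive_eq u v.
Proof.
split=> [|uv]; first exact: braid_eq_positive.
have L k x : all (fun i => i < n.-1) (numerator x ++ power k D).
  rewrite all_cat numerator_letters /=.
  by elim: k => //= k IH; rewrite all_cat full_twist_letters.
have := braid_eq_of_positive uv (L _ _).
rewrite !of_positive_cat !of_numerator -!catA -!of_positive_cat twist_power_comm.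
move: (of_positive _) => z uzvz.
have := braid_cat uzvz (braid_refl (inverse_word z)).
by rewrite -!catA !inverse_wordr !cats0.
Qed.

End Fractions.

(** * Enumerating a class of positive words *)

Definition expand (S : seq (seq nat)) := S ++ flatten (map rewrites S).

Lemma expand_sound k u v : v \in iter k expand [:: u] -> posequiv u v.
Proof.
elim: k v => [|k IH] v; first by rewrite inE => /eqP ->.
rewrite iterS mem_cat => /orP[/IH //|/flatten_mapP[x /IH ux xv]].
exact: posequiv_trans ux (posequiv_step xv (posequiv_refl _)).
Qed.

Definition rewrites_to : rel (seq nat) := [rel x y | y \in rewrites x].

Lemma expand_path k u p :
  path rewrites_to u p -> size p <= k -> last u p \in iter k expand [:: u].
Proof.
elim/last_ind: p k => [|p x IH] k.
  move=> _ _; elim: k => [|k IH]; first exact: mem_head.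
  by rewrite iterS mem_cat IH.
rewrite rcons_path size_rcons last_rcons; case: k => // k /andP[up px] pk.
rewrite iterS mem_cat; apply/orP; right; apply/flatten_mapP.
by exists (last u p) => //; apply: IH.
Qed.

Lemma posequiv_path u v : posequiv u v -> exists2 p, path rewrites_to u p & v = last u p.
Proof.
elim=> [w|x y z xy _ [p yp ->]]; first by exists [::].
by exists (y :: p) => //; apply/andP.
Qed.

Lemma path_posequiv u p x : path rewrites_to u p -> x \in u :: p -> posequiv u x.
Proof.
elim: p u => [|y p IH] u /=; first by rewrite inE => _ /eqP ->.
case/andP=> uy yp; rewrite inE => /orP[/eqP ->//|xp].
exact: posequiv_step uy (IH _ yp xp).
Qed.

Definition words (m l : nat) : seq (seq nat) :=
  [seq map val (tval t) | t <- enum {: l.-tuple 'I_m}].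

Lemma mem_words m u : all (fun i => i < m) u -> u \in words m (size u).
Proof.
move=> um; pose s : seq 'I_m := pmap insub u.
have sE : map val s = u.
  rewrite /s (pmap_filter (insubK _)); apply/all_filterP.
  by apply: sub_all um => i im; rewrite insubT.
have ss : size s == size u by rewrite -(size_map val) sE.
by apply/mapP; exists (Tuple ss); rewrite ?mem_enum // sE.
Qed.

(** A shortest chain of rewritings visits each word at most once, and all its
words have the length and the letters of u. *)
Lemma expand_complete m u v : all (fun i => i < m) u ->
  posequiv u v -> v \in iter (m ^ size u) expand [:: u].
Proof.
move=> um /posequiv_path[p up ->]; case: (shortenP up) => q uq quniq _.
apply: expand_path => //; apply: ltnW.
have -> : m ^ size u = size (words m (size u)).
  by rewrite size_map -cardE card_tuple card_ord.
apply: (uniq_leq_size quniq) => x /(path_posequiv uq) ux.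
by rewrite (posequiv_size ux); apply: mem_words; rewrite -(posequiv_all _ ux).
Qed.

(** * Recursive functions *)

Definition rec1 (f : nat -> nat) := recursive (fun x : 1.-tuple nat => f (tnth x ord0)).

Definition rec2 (f : nat -> nat -> nat) :=
  recursive (fun x : 2.-tuple nat => f (tnth x (inord 0)) (tnth x (inord 1))).

Definition rec3 (f : nat -> nat -> nat -> nat) :=
  recursive (fun x : 3.-tuple nat =>
    f (tnth x (inord 0)) (tnth x (inord 1)) (tnth x (inord 2))).

Lemma rec_succ : rec1 S.
Proof. by apply: recursive_ext recursive_succ. Qed.

Section Composition.
Variable k : nat.
Implicit Types g h : k.-tuple nat -> nat.

Lemma rec_comp1 f g : rec1 f -> recursive g -> recursive (fun x => f (g x)).
Proof.
move=> fr gr; apply: recursive_ext (recursive_comp fr (fun=> gr)) => x.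
by rewrite tnth_mktuple.
Qed.

Lemma rec_comp2 f g h :
  rec2 f -> recursive g -> recursive h -> recursive (fun x => f (g x) (h x)).
Proof.
move=> fr gr hr.
have gsr (i : 'I_2) : recursive (nth g [:: g; h] i) by case: i => [[|[|]]].
apply: recursive_ext (recursive_comp fr gsr) => x.
by rewrite !tnth_mktuple !inordK.
Qed.

Lemma rec_comp3 f g h e : rec3 f -> recursive g -> recursive h -> recursive e ->
  recursive (fun x => f (g x) (h x) (e x)).
Proof.
move=> fr gr hr er.
have gsr (i : 'I_3) : recursive (nth g [:: g; h; e] i) by case: i => [[|[|[|]]]].
apply: recursive_ext (recursive_comp fr gsr) => x.
by rewrite !tnth_mktuple !inordK.
Qed.

Lemma rec_const c : recursive (fun _ : k.-tuple nat => c).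
Proof.
elim: c => [|c IH].
  have emp (i : 'I_0) : recursive (fun _ : k.-tuple nat => 0) by case: i.
  by apply: recursive_ext (recursive_comp recursive_zero emp).
exact: rec_comp1 rec_succ IH.
Qed.

End Composition.

Lemma rec_prec f g h : rec1 f -> rec3 g ->
  (forall x, h 0 x = f x) -> (forall y x, h y.+1 x = g y (h y x) x) -> rec2 h.
Proof.
move=> fr gr h0 hS; apply: (recursive_prec fr gr) => [x|x y] /=.
  by rewrite !(tnth_nth 0) !inordK //= h0.
by rewrite !(tnth_nth 0) !inordK //= hS.
Qed.

Lemma rec_diag f : rec2 f -> rec1 (fun x => f x x).
Proof. by move=> fr; apply: rec_comp2 => //; exact: recursive_proj. Qed.

Ltac rec_var := by [exact: recursive_proj | exact: rec_const].

Lemma rec_id : rec1 id. Proof. exact: recursive_proj. Qed.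

Lemma rec_pred : rec1 predn.
Proof.
apply: (@rec_diag (fun y _ => y.-1)).
by apply: (@rec_prec (fun=> 0) (fun y _ _ => y)) => //; rec_var.
Qed.

Lemma rec_add : rec2 addn.
Proof.
apply: (@rec_prec id (fun _ r _ => r.+1)) => //; first exact: rec_id.
by apply: rec_comp1 rec_succ _; rec_var.
Qed.

Lemma rec_sub : rec2 subn.
Proof.
suff H : rec2 (fun y x => x - y) by apply: (rec_comp2 H); rec_var.
apply: (@rec_prec id (fun _ r _ => r.-1)).
- exact: rec_id.
- by apply: rec_comp1 rec_pred _; rec_var.
- exact: subn0.
- by move=> y x; rewrite subnS.
Qed.

Lemma rec_mul : rec2 muln.
Proof.
apply: (@rec_prec (fun=> 0) (fun _ r x => x + r)) => //; first by rec_var.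
by apply: rec_comp2 rec_add _ _; rec_var.
Qed.

Lemma rec_exp : rec2 expn.
Proof.
suff H : rec2 (fun y x => x ^ y) by apply: (rec_comp2 H); rec_var.
apply: (@rec_prec (fun=> 1) (fun _ r x => x * r)); first by rec_var.
- by apply: rec_comp2 rec_mul _ _; rec_var.
- by [].
- by move=> y x; rewrite expnS.
Qed.

Lemma rec_odd : rec1 odd.
Proof.
apply: (@rec_diag (fun y _ => odd y)).
apply: (@rec_prec (fun=> 0) (fun _ r _ => 1 - r)) => //; first by rec_var.
  by apply: rec_comp2 rec_sub _ _; rec_var.
by move=> y _ /=; case: odd.
Qed.

Lemma rec_half : rec1 half.
Proof.
apply: (@rec_diag (fun y _ => y./2)).
apply: (@rec_prec (fun=> 0) (fun y r _ => odd y + r)) => //; first by rec_var.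
  apply: rec_comp2 rec_add _ _; last by rec_var.
  by apply: rec_comp1 rec_odd _; rec_var.
by move=> y _ /=; rewrite uphalf_half.
Qed.

Definition choose_nat (b x y : nat) := b * x + (1 - b) * y.

Lemma rec_choose : rec3 choose_nat.
Proof.
apply: rec_comp2 rec_add _ _; apply: rec_comp2 rec_mul _ _; try by rec_var.
by apply: rec_comp2 rec_sub _ _; rec_var.
Qed.

Lemma choose_natE (b : bool) x y : choose_nat b x y = if b then x else y.
Proof. by case: b; rewrite /choose_nat ?mul1n ?mul0n ?addn0. Qed.

Lemma rec_iter f : rec1 f -> rec2 (fun k x => iter k f x).
Proof.
move=> fr; apply: (@rec_prec id (fun _ r _ => f r)) => //; first exact: rec_id.
by apply: rec_comp1 fr _; rec_var.
Qed.

(** Halve even numbers: iterated on 2^a (2b + 1), this stops at 2b + 1, which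
gives b, after a halvings, which gives a. *)
Definition strip c := choose_nat (odd c) c c./2.

Lemma rec_strip : rec1 strip.
Proof.
apply: rec_comp3 rec_choose _ _ _; first exact: rec_odd; last exact: rec_half.
exact: rec_id.
Qed.

(** The step of [CodeSeq.code], which prepends a to the list coded by b. *)
Definition code_cons (a b : nat) := 2 ^ a * b.*2.+1.

Lemma iter_strip k a b : iter k strip (code_cons a b) = code_cons (a - k) b.
Proof.
elim: k => [|k IH]; rewrite ?subn0 // iterS {}IH subnS /strip choose_natE /code_cons.
case: (a - k) => [|c]; first by rewrite mul1n /= odd_double.
by rewrite expnS -mulnA mul2n odd_double doubleK.
Qed.

Lemma ltn_code_cons a b : a < code_cons a b.
Proof.
by apply: leq_trans (ltn_expl a (ltnSn 1)) _; rewrite leq_pmulr.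
Qed.

(** For c = 2^a (2b + 1), c iterations are enough since a < 2^a <= c. *)
Definition code_tail c := (iter c strip c)./2.

Lemma code_tailE a b : code_tail (code_cons a b) = b.
Proof.
rewrite /code_tail iter_strip (eqP (ltnW (ltn_code_cons a b))).
by rewrite /code_cons mul1n /= uphalf_double.
Qed.

Lemma rec_tail : rec1 code_tail.
Proof.
apply: (rec_comp1 rec_half).
exact: (@rec_diag (fun k x => iter k strip x) (rec_iter rec_strip)).
Qed.

Fixpoint halvings k c :=
  if k is k'.+1 then halvings k' c + (1 - odd (iter k' strip c)) else 0.

Lemma halvingsE k a b : halvings k (code_cons a b) = minn k a.
Proof.
elim: k => [|k IH]; first by rewrite min0n.
rewrite /= IH iter_strip /code_cons; case E: (a - k) => [|c].
  by rewrite mul1n /= odd_double; lia.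
by rewrite expnS -mulnA mul2n odd_double; lia.
Qed.

Definition code_head c := halvings c c.

Lemma code_headE a b : code_head (code_cons a b) = a.
Proof. by rewrite /code_head halvingsE; apply/minn_idPr/ltnW/ltn_code_cons. Qed.

Lemma rec_head : rec1 code_head.
Proof.
apply: (@rec_diag halvings).
apply: (@rec_prec (fun=> 0) (fun y r x => r + (1 - odd (iter y strip x)))) => //.
  by rec_var.
apply: rec_comp2 rec_add _ _; first by rec_var.
apply: rec_comp2 rec_sub _ _; first by rec_var.
apply: rec_comp1 rec_odd _.
by apply: (rec_comp2 (rec_iter rec_strip)); rec_var.
Qed.

Lemma rec_code_cons : rec2 code_cons.
Proof.
apply: rec_comp2 rec_mul _ _.
  by apply: rec_comp2 rec_exp _ _; rec_var.
apply: rec_comp1 rec_succ _; apply: recursive_ext (rec_comp2 rec_add _ _).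
- by move=> x; rewrite -addnn.
- by rec_var.
- by rec_var.
Qed.

(** * Computable functions between coded types *)

HB.mixin Record Type_isCoded T := { enc : T -> nat; enc_inj : injective enc }.

#[short(type="codedType")]
HB.structure Definition Coded := { T of Type_isCoded T }.

Lemma code_inj : injective CodeSeq.code. Proof. exact: can_inj CodeSeq.codeK. Qed.

HB.instance Definition _ := Type_isCoded.Build nat (@inj_id nat).

Lemma nat_of_bool_inj : injective nat_of_bool. Proof. by case=> [] []. Qed.
HB.instance Definition _ := Type_isCoded.Build bool nat_of_bool_inj.

HB.instance Definition _ n := Type_isCoded.Build 'I_n val_inj.

Definition code_pair (A B : codedType) (p : A * B) := CodeSeq.code [:: enc p.1; enc p.2].
Lemma code_pair_inj A B : injective (@code_pair A B).
Proof. by move=> [a b] [c d] /code_inj [/enc_inj -> /enc_inj ->]. Qed.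
HB.instance Definition _ (A B : codedType) :=
  Type_isCoded.Build (A * B)%type (@code_pair_inj A B).

Lemma enc_pairE (A B : codedType) (p : A * B) :
  enc p = code_cons (enc p.1) (code_cons (enc p.2) 0).
Proof. by []. Qed.

Definition code_seq (A : codedType) (s : seq A) := CodeSeq.code (map enc s).
Lemma code_seq_inj A : injective (@code_seq A).
Proof. by move=> s t /code_inj /(inj_map enc_inj). Qed.
HB.instance Definition _ (A : codedType) := Type_isCoded.Build (seq A) (@code_seq_inj A).

Definition computable (A B : codedType) (f : A -> B) :=
  exists2 phi, rec1 phi & forall a, enc (f a) = phi (enc a).

Section Basics.
Variables X A B : codedType.

Lemma comp_ext (f g : X -> A) : f =1 g -> computable f -> computable g.
Proof. by move=> fg [phi r E]; exists phi => // a; rewrite -fg. Qed.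

Lemma comp_id : computable (fun x : X => x).
Proof. by exists id => //; exact: rec_id. Qed.

Lemma comp_const (a : A) : computable (fun _ : X => a).
Proof. by exists (fun=> enc a) => //; exact: rec_const. Qed.

Lemma comp_comp (g : A -> B) (f : X -> A) :
  computable g -> computable f -> computable (fun x => g (f x)).
Proof.
case=> psi rpsi Epsi [phi rphi Ephi]; exists (fun c => psi (phi c)).
  exact: rec_comp1 rpsi rphi.
by move=> x; rewrite Epsi Ephi.
Qed.

Lemma comp_pair (f : X -> A) (g : X -> B) :
  computable f -> computable g -> computable (fun x => (f x, g x)).
Proof.
case=> phi rphi Ephi [psi rpsi Epsi].
exists (fun c => code_cons (phi c) (code_cons (psi c) 0)).
  apply: rec_comp2 rec_code_cons _ _ => //.
  by apply: rec_comp2 rec_code_cons _ _ => //; exact: rec_const.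
by move=> x; rewrite -Ephi -Epsi.
Qed.

Lemma comp_fst (f : X -> A * B) : computable f -> computable (fun x => (f x).1).
Proof.
case=> phi rphi Ephi; exists (fun c => code_head (phi c)).
  exact: rec_comp1 rec_head rphi.
by move=> x; rewrite -Ephi enc_pairE code_headE.
Qed.

Lemma comp_snd (f : X -> A * B) : computable f -> computable (fun x => (f x).2).
Proof.
case=> phi rphi Ephi; exists (fun c => code_head (code_tail (phi c))).
  exact: rec_comp1 rec_head (rec_comp1 rec_tail rphi).
by move=> x; rewrite -Ephi enc_pairE code_tailE code_headE.
Qed.

Lemma comp_if (b : X -> bool) (f g : X -> A) : computable b -> computable f ->
  computable g -> computable (fun x => if b x then f x else g x).
Proof.
case=> beta rb Eb [phi rphi Ephi] [psi rpsi Epsi].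
exists (fun c => choose_nat (beta c) (phi c) (psi c)).
  exact: rec_comp3 rec_choose rb rphi rpsi.
by move=> x; rewrite -Eb choose_natE -Ephi -Epsi; case: (b x).
Qed.

Lemma comp_eq_enc (f g : X -> A) :
  computable f -> computable g -> computable (fun x => enc (f x) == enc (g x)).
Proof.
case=> phi rphi Ephi [psi rpsi Epsi].
exists (fun c => 1 - ((phi c - psi c) + (psi c - phi c))).
  apply: rec_comp2 rec_sub _ _; first exact: rec_const.
  by apply: rec_comp2 rec_add _ _; apply: rec_comp2 rec_sub _ _.
move=> x; rewrite -Ephi -Epsi [enc _]/(nat_of_bool _).
by case: eqP; lia.
Qed.

Lemma comp_iter (k : X -> nat) (g : X -> A -> A) (h : X -> A) :
  computable k -> computable (fun p : X * A => g p.1 p.2) -> computable h ->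
  computable (fun x => iter (k x) (g x) (h x)).
Proof.
case=> kappa rk Ek [gamma rg Eg] [eta rh Eh].
pose step p := code_cons (code_head p) (code_cons (gamma p) 0).
exists (fun c => code_head (code_tail
  (iter (kappa c) step (code_cons c (code_cons (eta c) 0))))).
  apply: rec_comp1 rec_head _; apply: rec_comp1 rec_tail _.
  have rstep : rec1 step.
    apply: rec_comp2 rec_code_cons _ _; first exact: rec_head.
    by apply: rec_comp2 rec_code_cons _ _ => //; exact: rec_const.
  apply: rec_comp2 (rec_iter rstep) _ _ => //.
  apply: rec_comp2 rec_code_cons _ _; first by rec_var.
  by apply: rec_comp2 rec_code_cons _ _ => //; exact: rec_const.
move=> x; rewrite -Ek -Eh.
suff -> : iter (k x) step (code_cons (enc x) (code_cons (enc (h x)) 0)) =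
    enc (x, iter (k x) (g x) (h x)).
  by rewrite enc_pairE code_tailE code_headE.
elim: (k x) => [//|i IH]; rewrite !iterS IH /step -Eg.
by rewrite [code_head _]code_headE.
Qed.

End Basics.

Section Arithmetic.
Variable X : codedType.
Implicit Types f g : X -> nat.

Lemma comp_nat2 op f g :
  rec2 op -> computable f -> computable g -> computable (fun x => op (f x) (g x)).
Proof.
move=> rop [phi rphi Ephi] [psi rpsi Epsi]; exists (fun c => op (phi c) (psi c)).
  exact: rec_comp2.
by move=> x; rewrite -Ephi -Epsi.
Qed.

Definition comp_add f g := @comp_nat2 addn f g rec_add.
Definition comp_sub f g := @comp_nat2 subn f g rec_sub.
Definition comp_exp f g := @comp_nat2 expn f g rec_exp.

Lemma comp_half f : computable f -> computable (fun x => (f x)./2).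
Proof. by apply: comp_comp; exists half => //; exact: rec_half. Qed.

Lemma comp_odd f : computable f -> computable (fun x => odd (f x)).
Proof. by apply: comp_comp; exists odd => //; exact: rec_odd. Qed.

Lemma comp_eqn f g : computable f -> computable g -> computable (fun x => f x == g x).
Proof. exact: comp_eq_enc. Qed.

Lemma comp_leq f g : computable f -> computable g -> computable (fun x => f x <= g x).
Proof. by move=> cf cg; apply: comp_eqn; [exact: comp_sub | exact: comp_const]. Qed.

Lemma comp_S f : computable f -> computable (fun x => (f x).+1).
Proof. by apply: comp_comp; exists succn => //; exact: rec_succ. Qed.

End Arithmetic.

Section Booleans.
Variables (X : codedType) (a b : X -> bool).
Hypotheses (ca : computable a) (cb : computable b).

Lemma comp_negb : computable (fun x => ~~ a x).
Proof. by apply: comp_if => //; exact: comp_const. Qed.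

Lemma comp_andb : computable (fun x => a x && b x).
Proof. by apply: comp_if => //; exact: comp_const. Qed.

Lemma comp_orb : computable (fun x => a x || b x).
Proof. by apply: comp_if => //; exact: comp_const. Qed.

End Booleans.

Section Lists.
Variables X A B : codedType.

Lemma comp_cons (f : X -> A) (s : X -> seq A) :
  computable f -> computable s -> computable (fun x => f x :: s x).
Proof.
case=> phi rphi Ephi [psi rpsi Epsi]; exists (fun c => code_cons (phi c) (psi c)).
  exact: rec_comp2 rec_code_cons _ _.
by move=> x; rewrite -Ephi -Epsi.
Qed.

Lemma comp_behead (s : X -> seq A) : computable s -> computable (fun x => behead (s x)).
Proof.
apply: comp_comp; exists code_tail; first exact: rec_tail.
by case=> [//|a l]; rewrite [RHS]code_tailE.
Qed.

Lemma comp_nilp (s : X -> seq A) : computable s -> computable (fun x => nilp (s x)).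
Proof.
move=> cs; apply: comp_ext (comp_eq_enc cs (comp_const X [::])) => x.
case: (s x) => [//|a l]; apply: gtn_eqF.
by rewrite [X in _ < X]/(code_cons _ _) muln_gt0 expn_gt0.
Qed.

Lemma comp_head (d : X -> A) (s : X -> seq A) :
  computable d -> computable s -> computable (fun x => head (d x) (s x)).
Proof.
move=> [phi rphi Ephi] cs; have [beta rb Eb] := comp_nilp cs.
case: cs => psi rpsi Epsi.
exists (fun c => choose_nat (beta c) (phi c) (code_head (psi c))).
  apply: rec_comp3 rec_choose rb rphi _; exact: rec_comp1 rec_head rpsi.
move=> x; rewrite -Eb choose_natE -Ephi -Epsi; case: (s x) => [//|a l].
by rewrite [RHS]code_headE.
Qed.

End Lists.

Section Nth.
Variables X A : codedType.

Lemma comp_nth (d : X -> A) (s : X -> seq A) (k : X -> nat) : computable d ->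
  computable s -> computable k -> computable (fun x => nth (d x) (s x) (k x)).
Proof.
move=> cd cs ck.
apply: (@comp_ext _ _ (fun x => head (d x) (iter (k x) behead (s x)))) => [x|].
  by rewrite -nth0 -[in RHS](addn0 (k x)) -nth_drop; elim: (k x) {ck} (s x) => [|i IH] l;
    rewrite ?drop0 // iterSr IH; case: l => //; rewrite /= drop_nil.
apply: comp_head => //; apply: (comp_iter (g := fun _ => behead)) => //.
exact/comp_behead/comp_snd/comp_id.
Qed.

End Nth.

Lemma leq_size_code (s : seq nat) : size s <= CodeSeq.code s.
Proof.
by elim: s => //= a s IH; apply: leq_ltn_trans IH (leq_trans _ (leq_pmull _ _));
  rewrite ?expn_gt0 // -addnn ltnS leq_addr.
Qed.

Lemma enc_seq_nat (s : seq nat) : enc s = CodeSeq.code s.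
Proof. by congr CodeSeq.code; apply: map_id. Qed.

Section Fold.
Variables X A B : codedType.

(** The fold is an iteration of a step that consumes the head of the list.  It
is carried out on codes, that is on lists of numbers, so that [head] has the
default value 0 even if B is empty; the code of the list bounds its size, and
further steps leave the state unchanged. *)
Lemma comp_foldl (g : X -> A -> B -> A) (h : X -> A) (s : X -> seq B) :
  computable (fun p : X * (A * B) => g p.1 p.2.1 p.2.2) -> computable h ->
  computable s -> computable (fun x => foldl (g x) (h x) (s x)).
Proof.
case=> gamma rg Eg [eta rh Eh] [sigma rs Es].
pose dec c : seq nat := CodeSeq.decode (sigma c).
pose step (c : nat) (p : seq nat * nat) : seq nat * nat :=
  if nilp p.1 then p else (behead p.1, gamma (enc (c, (p.2, head 0 p.1)))).
have cg : computable gamma by exists gamma.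
have cstep : computable (fun q : nat * (seq nat * nat) => step q.1 q.2).
  have c2 := comp_snd (comp_id (nat * (seq nat * nat))%type).
  apply: comp_if; [exact/comp_nilp/comp_fst | exact: c2 |].
  apply: comp_pair; first exact/comp_behead/comp_fst.
  apply: comp_comp cg _.
  suff C : computable (fun q : nat * (seq nat * nat) => (q.1, (q.2.2, head 0 q.2.1))).
    by case: C => phi r E; exists phi.
  apply: comp_pair; first exact/comp_fst/comp_id.
  apply: comp_pair; first exact/comp_snd.
  by apply: comp_head; [exact: comp_const | exact: comp_fst].
have [phi rphi Ephi] : computable (fun c => (iter (sigma c) (step c) (dec c, eta c)).2).
  apply: comp_snd; apply: comp_iter => //; first by exists sigma.
  apply: comp_pair; last by exists eta.
  by exists sigma => // c; rewrite enc_seq_nat CodeSeq.decodeK.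
exists phi => // x; rewrite -Ephi [RHS]/= -Eh /dec -Es.
rewrite [CodeSeq.decode _]CodeSeq.codeK.
have : size (map enc (s x)) <= enc (s x) by exact: leq_size_code.
elim: (s x) (enc (s x)) (h x) => [|b l IH] k a /=.
  move=> _; suff -> : iter k (step (enc x)) ([::], enc a) = ([::], enc a) by [].
  by elim: k => // k IH; rewrite iterS IH.
case: k => // k lk; rewrite iterSr.
rewrite -[step _ _]/(map enc l, gamma (enc (x, (a, b)))) -Eg /=.
exact: IH.
Qed.

End Fold.

Lemma comp_rev (X A : codedType) (s : X -> seq A) :
  computable s -> computable (fun x => rev (s x)).
Proof.
move=> cs; apply: (@comp_ext _ _ (fun x => foldl (fun t a => a :: t) [::] (s x))).
  by move=> x; rewrite /rev; elim: (s x) [::] => //= a l IH t; rewrite IH.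
apply: (comp_foldl (g := fun _ t a => a :: t)) => //; last exact: comp_const.
by apply: comp_cons; [exact/comp_snd/comp_snd/comp_id | exact/comp_fst/comp_snd/comp_id].
Qed.

Section MoreLists.
Variables X A B : codedType.

Lemma comp_foldr (g : X -> B -> A -> A) (h : X -> A) (s : X -> seq B) :
  computable (fun p : X * (A * B) => g p.1 p.2.2 p.2.1) -> computable h ->
  computable s -> computable (fun x => foldr (g x) (h x) (s x)).
Proof.
move=> cg ch cs.
apply: (@comp_ext _ _ (fun x => foldl (fun a b => g x b a) (h x) (rev (s x)))).
  by move=> x; rewrite foldl_rev.
by apply: (comp_foldl (g := fun x a b => g x b a)) => //; exact: comp_rev.
Qed.

End MoreLists.

Section Iterators.
Variables X A B : codedType.

Lemma comp_cat (s t : X -> seq A) :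
  computable s -> computable t -> computable (fun x => s x ++ t x).
Proof.
move=> cs ct; apply: (@comp_ext _ _ (fun x => foldr cons (t x) (s x))).
  by move=> x; elim: (s x) => //= a l ->.
apply: (comp_foldr (g := fun _ => cons)) => //.
by apply: comp_cons; [exact/comp_snd/comp_snd/comp_id | exact/comp_fst/comp_snd/comp_id].
Qed.

Lemma comp_map (f : X -> A -> B) (s : X -> seq A) :
  computable (fun p : X * A => f p.1 p.2) -> computable s ->
  computable (fun x => map (f x) (s x)).
Proof.
move=> cf cs.
apply: (@comp_ext _ _ (fun x => foldr (fun a t => f x a :: t) [::] (s x))) => //.
apply: (comp_foldr (g := fun x a t => f x a :: t)) => //; last exact: comp_const.
have ci := comp_id (X * (seq B * A))%type.
apply: comp_cons; last exact/comp_fst/comp_snd.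
apply: (@comp_comp _ _ _ (fun p : X * A => f p.1 p.2) (fun p => (p.1, p.2.2)) cf).
by apply: comp_pair; [exact: comp_fst | exact/comp_snd/comp_snd].
Qed.

Lemma comp_has (f : X -> A -> bool) (s : X -> seq A) :
  computable (fun p : X * A => f p.1 p.2) -> computable s ->
  computable (fun x => has (f x) (s x)).
Proof.
move=> cf cs.
apply: (@comp_ext _ _ (fun x => foldr (fun a b => f x a || b) false (s x))) => //.
apply: (comp_foldr (g := fun x a b => f x a || b)) => //; last exact: comp_const.
have ci := comp_id (X * (bool * A))%type.
apply: comp_orb; last exact/comp_fst/comp_snd.
apply: (@comp_comp _ _ _ (fun p : X * A => f p.1 p.2) (fun p => (p.1, p.2.2)) cf).
by apply: comp_pair; [exact: comp_fst | exact/comp_snd/comp_snd].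
Qed.

Lemma comp_size (s : X -> seq A) : computable s -> computable (fun x => size (s x)).
Proof.
move=> cs; apply: (@comp_ext _ _ (fun x => foldr (fun _ => succn) 0 (s x))) => //.
apply: (comp_foldr (g := fun _ _ => succn)) => //; last exact: comp_const.
exact/comp_S/comp_fst/comp_snd/comp_id.
Qed.

End Iterators.

Lemma comp_iota (X : codedType) (k : X -> nat) :
  computable k -> computable (fun x => iota 0 (k x)).
Proof.
move=> ck.
apply: (@comp_ext _ _ (fun x => iter (k x) (fun s => s ++ [:: size s]) [::])).
  move=> x; elim: (k x) => // i IH.
  by rewrite iterS IH -[in RHS]addn1 iotaD size_iota.
apply: (comp_iter (g := fun _ s => s ++ [:: size s])) => //; last exact: comp_const.
have c2 := comp_snd (comp_id (X * seq nat)%type).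
by apply: comp_cat => //; apply: comp_cons; [exact: comp_size | exact: comp_const].
Qed.

Section FlattenFinite.
Variables X A B : codedType.

Lemma comp_flatten (s : X -> seq (seq A)) :
  computable s -> computable (fun x => flatten (s x)).
Proof.
move=> cs; apply: (comp_foldr (g := fun _ => cat)) => //; last exact: comp_const.
by apply: comp_cat; [exact/comp_snd/comp_snd/comp_id | exact/comp_fst/comp_snd/comp_id].
Qed.

(** A function on a finite type is a table: compare the code of the argument with
each code in turn. *)
Lemma comp_finite (T : finType) (c : T -> A) (f : A -> B) :
  (forall a, exists t, a = c t) -> computable f.
Proof.
move=> cT; have [phi rphi Ephi] :
    exists2 phi, rec1 phi & forall t, t \in enum T -> enc (f (c t)) = phi (enc (c t)).
  elim: (enum T) => [|t e [phi rphi Ephi]]; first by exists id => //; exact: rec_id.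
  have [beta rb Eb] := comp_eqn (comp_id nat) (comp_const nat (enc (c t))).
  exists (fun k => choose_nat (beta k) (enc (f (c t))) (phi k)).
    by apply: rec_comp3 rec_choose rb _ rphi; exact: rec_const.
  move=> u; rewrite inE -[beta _]Eb choose_natE.
  case: (enc (c u) =P enc (c t)) => [/enc_inj -> //|neq].
  by case/orP=> [/eqP E|/Ephi //]; case: neq; rewrite E.
by exists phi => // a; have [t ->] := cT a; apply: Ephi; rewrite mem_enum.
Qed.

End FlattenFinite.

(** A property determined by the values of finitely many computable tests is
decidable, whatever the property: some table of truth values fits it.  The
table is built by induction on the list of tests, and its entries are obtained
by excluded middle. *)
Lemma decide_finite (T : finType) (X : codedType) (p : T -> X -> bool)
    (Q : X -> Prop) :
  (forall t, computable (p t)) ->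
  (forall x y, (forall t, p t x = p t y) -> Q x -> Q y) ->
  exists2 b : X -> bool, computable b & forall x, b x <-> Q x.
Proof.
move=> cp HQ; suff H (e : seq T) (R : X -> Prop) :
    (forall x y, (forall t, t \in e -> p t x = p t y) -> R x -> R y) ->
    exists2 b : X -> bool, computable b & forall x, b x <-> R x.
  apply: (H (enum T)) => x y pxy; apply: HQ => t.
  by apply: pxy; rewrite mem_enum.
elim: e R => [|t e IH] R HR.
  have [[x Rx]|nR] := classic (exists x, R x).
    exists (fun=> true); first exact: comp_const.
    by move=> y; split=> // _; apply: HR Rx.
  exists (fun=> false); first exact: comp_const.
  by move=> y; split=> // Ry; case: nR; exists y.
pose S c x := exists y, [/\ p t y = c, R y & forall u, u \in e -> p u y = p u x].
have HS c x y : (forall u, u \in e -> p u x = p u y) -> S c x -> S c y.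
  by move=> E [z [pz Rz Ez]]; exists z; split=> // u ue; rewrite Ez // E.
have [b1 cb1 E1] := IH _ (HS true); have [b0 cb0 E0] := IH _ (HS false).
exists (fun x => if p t x then b1 x else b0 x); first exact: comp_if.
move=> x; have -> : (if p t x then b1 x else b0 x) <-> S (p t x) x by case: (p t x).
split=> [[y [py Ry Ey]]|Rx]; last by exists x.
by apply: HR Ry => u; rewrite inE => /orP[/eqP ->|]; [exact: py | exact: Ey].
Qed.

Ltac comp_step :=
  first
  [ assumption
  | apply: comp_id
  | apply: comp_const
  | lazymatch goal with
    | |- computable (fun x => fst (@?f x)) => apply: comp_fst
    | |- computable (fun x => snd (@?f x)) => apply: comp_snd
    | |- computable (fun x => pair (@?f x) (@?g x)) => apply: comp_pair
    | |- computable (fun x => (@?a x) && (@?b x)) => apply: comp_andb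
    | |- computable (fun x => (@?a x) || (@?b x)) => apply: comp_orb
    | |- computable (fun x => ~~ (@?a x)) => apply: comp_negb
    | |- computable (fun x => addn (@?f x) (@?g x)) => apply: comp_add
    | |- computable (fun x => subn (@?f x) (@?g x)) => apply: comp_sub
    | |- computable (fun x => expn (@?f x) (@?g x)) => apply: comp_exp
    | |- computable (fun x => leq (@?f x) (@?g x)) => apply: comp_leq
    | |- computable (fun x => odd (@?f x)) => apply: comp_odd
    | |- computable (fun x => half (@?f x)) => apply: comp_half
    | |- computable (fun x => S (@?f x)) => apply: comp_S
    | |- computable (fun x => enc (@?f x) == enc (@?g x)) => apply: comp_eq_enc
    | |- computable (fun x => @eq_op _ (@?f x) (@?g x)) => apply: comp_eqn
    | |- computable (fun x => cons (@?f x) (@?g x)) => apply: comp_cons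
    | |- computable (fun x => behead (@?f x)) => apply: comp_behead
    | |- computable (fun x => nilp (@?f x)) => apply: comp_nilp
    | |- computable (fun x => head (@?d x) (@?f x)) => apply: comp_head
    | |- computable (fun x => nth (@?d x) (@?f x) (@?g x)) => apply: comp_nth
    | |- computable (fun x => size (@?f x)) => apply: comp_size
    | |- computable (fun x => iota 0 (@?f x)) => apply: comp_iota
    | |- computable (fun x => cat (@?f x) (@?g x)) => apply: comp_cat
    | |- computable (fun x => flatten (@?f x)) => apply: comp_flatten
    | |- computable (fun x => map (@?f x) (@?g x)) => apply: comp_map
    | |- computable (fun x => has (@?f x) (@?g x)) => apply: comp_has
    | |- computable (fun x => iter (@?f x) (@?g x) (@?h x)) => apply: comp_iter
    | |- computable (fun x => foldr (@?f x) (@?g x) (@?h x)) => apply: comp_foldr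
    end
  | apply: comp_if ].

(* [foldr f z] and its like are partial applications: expose the variable *)
Ltac comp_eta :=
  lazymatch goal with
  | |- computable (fun _ => _) => idtac
  | |- @computable ?A ?B ?f => apply: (@comp_ext A B (fun x => f x) f (fun=> erefl))
  end.

Ltac computability := repeat (comp_eta; comp_step).

(** * Computability of the braid word problem *)

Definition rewrites_head (i : nat) (u : seq nat) : seq (seq nat) :=
  if nilp u then [::] else
  (if far i (head 0 u) then [:: [:: head 0 u, i & behead u]] else [::]) ++
  (if nilp (behead u) then [::] else
   if near i (head 0 u) && (head 0 (behead u) == i)
   then [:: [:: head 0 u, i, head 0 u & behead (behead u)]] else [::]).

Lemma rewrites_consE i u :
  rewrites (i :: u) = rewrites_head i u ++ map (cons i) (rewrites u).
Proof. by case: u => [|j [|k u]] //; rewrite /rewrites_head /= -?catA. Qed.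

(** [rewrites w] is recursive in the tail of w, which the fold has to return
together with the neighbours of the tail. *)
Lemma comp_rewrites : computable rewrites.
Proof.
pose step i (p : seq nat * seq (seq nat)) :=
  (i :: p.1, rewrites_head i p.1 ++ map (cons i) p.2).
apply: (@comp_ext _ _ (fun w => (foldr step ([::], [::]) w).2)).
  move=> w; suff -> : foldr step ([::], [::]) w = (w, rewrites w) by [].
  by elim: w => [|i u IH] //; rewrite [LHS]/= IH /step -rewrites_consE.
rewrite /step /rewrites_head /near /far; computability.
Qed.

Lemma comp_expand : computable expand.
Proof.
rewrite /expand; computability.
by apply: (comp_comp comp_rewrites); computability.
Qed.

Section BraidDecision.
Variable n : nat.

Lemma comp_numerator : computable (@numerator n).
Proof.
have cl : computable (@numerator_letter n).
  by apply: (@comp_finite _ _ ('I_n.-1 * bool)%type id) => a; exists a.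
apply: (comp_flatten (s := map (@numerator_letter n))).
apply: (comp_map (f := fun=> @numerator_letter n)); last exact: comp_id.
by apply: (comp_comp cl); computability.
Qed.

Definition decide_braid_eq (u v : word n) : bool :=
  let x := numerator u ++ power (denominator v) (full_twist n.-1) in
  let y := numerator v ++ power (denominator u) (full_twist n.-1) in
  y \in iter (n.-1 ^ size x) expand [:: x].

Lemma decide_braid_eqP u v : reflect (braid_eq u v) (decide_braid_eq u v).
Proof.
apply: (iffP idP) => [uv|/braid_eqE uv].
  by apply/braid_eqE; move: uv; apply: expand_sound.
apply: expand_complete uv; rewrite all_cat numerator_letters /=.
by elim: (denominator v) => //= k IH; rewrite all_cat full_twist_letters.
Qed.

Lemma comp_decide_braid_eq :
  computable (fun p : word n * word n => decide_braid_eq p.1 p.2).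
Proof.
rewrite /decide_braid_eq /=.
have cnum (f : word n * word n -> word n) :
    computable f -> computable (fun p => numerator (f p)).
  by apply: comp_comp; exact: comp_numerator.
have cden : computable (@denominator n).
  apply: (@comp_ext _ _ (foldr (fun a k => nat_of_bool (~~ a.2) + k) 0)).
    by elim=> //= a u ->.
  by computability.
have cpow (f : word n * word n -> word n) : computable f ->
    computable (fun p : word n * word n => power (denominator (f p)) (full_twist n.-1)).
  move=> cf; apply: (@comp_ext _ _
    (fun p => iter (denominator (f p)) (cat (full_twist n.-1)) [::])).
    by move=> p; elim: (denominator _) => //= k ->.
  apply: (comp_iter (g := fun=> cat (full_twist n.-1))); last exact: comp_const.
    exact: comp_comp cden cf.
  by computability.
have c1 := comp_fst (comp_id (word n * word n)%type).
have c2 := comp_snd (comp_id (word n * word n)%type).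
pose side (f g : word n * word n -> word n) p :=
  numerator (f p) ++ power (denominator (g p)) (full_twist n.-1).
have cside f g : computable f -> computable g -> computable (side f g).
  by move=> cf cg; apply: comp_cat; [exact: cnum | exact: cpow].
have cx := cside _ _ c1 c2; have cy := cside _ _ c2 c1.
apply: (@comp_ext _ _ (fun p => has (fun z : seq nat => enc z == enc (side snd fst p))
  (iter (n.-1 ^ size (side fst snd p)) expand [:: side fst snd p]))).
  move=> p; rewrite -has_pred1; apply: eq_has => z.
  by rewrite /= (inj_eq (@enc_inj (seq nat))).
computability.
  by apply: (comp_comp cy); computability.
by apply: (comp_comp comp_expand); computability.
Qed.
End BraidDecision.

(** * Computability of the pattern conditions *)

Lemma code_cell_inj n : injective (@code_cell n).
Proof. by case=> [|i|i|i|i|i|i|i] [|j|j|j|j|j|j|j] /code_inj //= [/val_inj ->]. Qed.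
HB.instance Definition _ n := Type_isCoded.Build (cell n) (@code_cell_inj n).

Lemma code_int_inj : injective code_int.
Proof. by case=> a [] b /code_inj //= [->]. Qed.
HB.instance Definition _ := Type_isCoded.Build int code_int_inj.

Lemma code_generation_inj n : injective (@code_generation n).
Proof.
case=> [p s P] [q t Q] /code_inj /= [/code_int_inj Epq /(inj_map (@code_cell_inj n)) Est].
by case: _ / Epq; case: _ / Est Q => Q; rewrite (bool_irrelevance P Q).
Qed.
HB.instance Definition _ n := Type_isCoded.Build (generation n) (@code_generation_inj n).

Lemma comp_pos n : computable (@pos n).
Proof. by exists code_head; [exact: rec_head | case=> p s P; rewrite [RHS]code_headE]. Qed.

Lemma comp_cells n : computable (@cells n).
Proof. by exists code_tail; [exact: rec_tail | case=> p s P; rewrite [RHS]code_tailE]. Qed.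

(** A finite type that covers the cells: the four kinds of cell with one strand,
the three kinds with two strands, and the empty cell. *)
Definition cell_index n := option ('I_4 * 'I_n + 'I_3 * 'I_n.-1)%type.

Definition cell_of_index n (t : cell_index n) : cell n :=
  match t with
  | None => NN
  | Some (inl (k, i)) => nth (@SN n) [:: @SN n; @NS n; @RN n; @NL n] k i
  | Some (inr (k, i)) => nth (@SS n) [:: @SS n; @RL n; @RLbar n] k i
  end.

Lemma cell_of_index_surj n (c : cell n) : exists t, c = cell_of_index t.
Proof.
case: c => [|i|i|i|i|i|i|i]; first by exists None.
- by exists (Some (inl (inord 0, i))); rewrite /= inordK.
- by exists (Some (inl (inord 1, i))); rewrite /= inordK.
- by exists (Some (inl (inord 2, i))); rewrite /= inordK.
- by exists (Some (inl (inord 3, i))); rewrite /= inordK.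
- by exists (Some (inr (inord 0, i))); rewrite /= inordK.
- by exists (Some (inr (inord 1, i))); rewrite /= inordK.
- by exists (Some (inr (inord 2, i))); rewrite /= inordK.
Qed.

Lemma comp_psi n : computable (@psi n).
Proof.
have cp : computable (@psi_cell n) by apply: comp_finite (@cell_of_index_surj n).
apply: comp_flatten.
apply: (comp_map (f := fun=> fun G : generation n =>
    flatten (map (@psi_cell n) (cells G)))); last exact: comp_id.
apply: comp_flatten; apply: (comp_map (f := fun=> @psi_cell n)).
  by apply: (comp_comp cp); computability.
by apply: (comp_comp (@comp_cells n)); computability.
Qed.

Definition int_parts (z : int) : nat * nat :=
  match z with Posz m => (0, m) | Negz m => (1, m) end.

Lemma comp_int_parts : computable int_parts.
Proof. by exists id; [exact: rec_id | case]. Qed.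

Definition magnitude (z : int) : nat :=
  if (int_parts z).1 == 0 then (int_parts z).2 else (int_parts z).2.+1.

Lemma magnitudeE z : magnitude z = `|z|%N. Proof. by case: z. Qed.

(** z + k, computed in the natural numbers; this is exact if |z| <= k. *)
Definition shifted (k : nat) (z : int) : nat :=
  if (int_parts z).1 == 0 then (int_parts z).2 + k else k - (int_parts z).2.+1.

Lemma shiftedE k z : magnitude z <= k -> Posz (shifted k z) = (z + Posz k)%R.
Proof. by case: z => m; rewrite /shifted /magnitude /=; lia. Qed.

Section Adjacent.
Variable n : nat.

Definition cell_at_nat (p : nat) (s : seq (cell n)) (j : nat) : cell n :=
  if p <= j then nth NN s (j - p)./2 else NN.

(** Positions are shifted by an amount that makes all those that matter
nonnegative: the least of them is two to the left of a generation. *)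
Definition offset (G H : generation n) : nat :=
  (magnitude (pos G) + magnitude (pos H)).+2.

Definition left_end (G H K : generation n) : nat := shifted (offset G H) (pos K).

Definition child_in (A B C : cell n) (G H : generation n) : bool :=
  let p := left_end G H G in let q := left_end G H H in
  has (fun j => [&& ~~ odd (j + p), enc A == enc (cell_at_nat p (cells G) j),
                    enc B == enc (cell_at_nat p (cells G) j.+2)
                  & enc C == enc (cell_at_nat q (cells H) j.+1)])
      (iota 0 (p + q + (size (cells G) + size (cells H)
                        + (size (cells G) + size (cells H))))).

Definition in_phase (G H : generation n) : bool :=
  odd (left_end G H G + left_end G H H).

Lemma left_endG G H : Posz (left_end G H G) = (pos G + Posz (offset G H))%R.
Proof. by apply: shiftedE; rewrite /offset; lia. Qed.

Lemma left_endH G H : Posz (left_end G H H) = (pos H + Posz (offset G H))%R.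
Proof. by apply: shiftedE; rewrite /offset; lia. Qed.

Lemma cell_at_shift (G : generation n) (k p j : nat) (z : int) :
  Posz p = (pos G + Posz k)%R -> Posz j = (z + Posz k)%R ->
  cell_at G z = cell_at_nat p (cells G) j.
Proof.
move=> pE jE; rewrite /cell_at /cell_at_nat.
have -> : (pos G <= z)%R = (p <= j) by lia.
by case: ifP => // pj; congr (nth _ _ _./2); lia.
Qed.

Lemma is_left_pos_shift (G : generation n) (k p j : nat) (z : int) :
  Posz p = (pos G + Posz k)%R -> Posz j = (z + Posz k)%R ->
  is_left_pos G z = ~~ odd (j + p).
Proof.
move=> pE jE; rewrite /is_left_pos.
have -> : (z - pos G)%R = (Posz j - Posz p)%R by lia.
by apply/idP/idP; lia.
Qed.

Lemma in_phaseE G H : in_phase G H = is_left_pos H (pos G + 1)%R.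
Proof.
rewrite (@is_left_pos_shift H (offset G H) (left_end G H H) (left_end G H G).+1).
- by rewrite /in_phase /= negbK.
- exact: left_endH.
- by have := left_endG G H; lia.
Qed.

Lemma cell_at_nonempty (G : generation n) (z : int) : cell_at G z <> NN ->
  (pos G <= z < pos G + Posz (size (cells G) + size (cells G)))%R.
Proof.
rewrite /cell_at; case: ifP => // pz ne; rewrite andTb.
case: (ltnP `|(z - pos G)%R|%N./2 (size (cells G))) => [lt|ge];
  last by rewrite nth_default in ne.
by lia.
Qed.

Lemma child_in_sound A B C G H : child_in A B C G H ->
  exists j, [/\ is_left_pos G j, A = cell_at G j, B = cell_at G (j + 2)%R
    & C = cell_at H (j + 1)%R].
Proof.
case/hasP=> j _ /and4P[oj /eqP/enc_inj -> /eqP/enc_inj -> /eqP/enc_inj ->].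
have pE := left_endG G H; have qE := left_endH G H.
exists (Posz j - Posz (offset G H))%R.
split; first by rewrite (is_left_pos_shift (j := j) pE) //; lia.
- by apply/esym/(cell_at_shift pE); lia.
- by apply/esym/(cell_at_shift pE); lia.
- by apply/esym/(cell_at_shift qE); lia.
Qed.

(** A position where one of the three cells is not empty lies in the range
searched by [child_in]; the empty triple also occurs arbitrarily far away. *)
Lemma child_in_complete A B C G H j : is_left_pos G j -> A = cell_at G j ->
  B = cell_at G (j + 2)%R -> C = cell_at H (j + 1)%R ->
  [/\ A = NN, B = NN & C = NN] \/ child_in A B C G H.
Proof.
move=> lj AE BE CE.
have NN_dec (c : cell n) : c = NN \/ c <> NN by case: c; [left | right ..].
have [|ne] : [/\ A = NN, B = NN & C = NN] \/ [\/ A <> NN, B <> NN | C <> NN].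
- case: (NN_dec A) => ?; last by right; constructor 1.
  case: (NN_dec B) => ?; last by right; constructor 2.
  by case: (NN_dec C) => ?; [left | right; constructor 3].
- by left.
right; have pE := left_endG G H; have qE := left_endH G H.
pose size2 := size (cells G) + size (cells H).
have [i iE lt_i] : exists2 i : nat, Posz i = (j + Posz (offset G H))%R
    & i < left_end G H G + left_end G H H + (size2 + size2).
  exists `|(j + Posz (offset G H))%R|%N;
  move: pE qE; rewrite /offset /size2 !magnitudeE;
  by case: ne; rewrite ?AE ?BE ?CE => /cell_at_nonempty; lia.
apply/hasP; exists i; rewrite ?mem_iota ?add0n //.
rewrite -(is_left_pos_shift pE iE) lj AE BE CE.
rewrite (cell_at_shift pE iE) (cell_at_shift (j := i.+2) pE)
  ?(cell_at_shift (j := i.+1) qE) ?eqxx //; lia.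
Qed.

End Adjacent.

(** * Deciding SCA patterns *)

Section Patterns.
Variable n : nat.
Implicit Types (g : grid_pattern n) (G H : generation n) (A B C : cell n).

(** The fold returns the list already read along with the answer, so that the
next generation is available; [head] is only applied to a list tested not to be empty. *)
Definition some_consecutive (P : generation n -> generation n -> bool) g : bool :=
  (foldr (fun G s => (G :: s.1, ~~ nilp s.1 && P G (head G s.1) || s.2))
         ([::], false) g).2.

Lemma some_consecutiveP (P : generation n -> generation n -> bool) g :
  reflect (exists G H, consecutive g G H /\ P G H) (some_consecutive P g).
Proof.
have E h : foldr (fun G s => (G :: s.1, ~~ nilp s.1 && P G (head G s.1) || s.2))
    ([::], false) h = (h, some_consecutive P h).
  by elim: h => [|G h IH] //; rewrite /some_consecutive /= IH.
elim: g => [|G g IH].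
  by constructor=> -[G [H [[[|? ?] [? //]]]]].
rewrite /some_consecutive /= E /=; apply: (iffP orP) => [[|/IH]|].
- case: g {IH E} => //= H g PGH; exists G, H; split=> //.
  by exists [::], g.
- case=> K [H [[g1 [g2 ->]] PKH]]; exists K, H; split=> //.
  by exists (G :: g1), g2.
- case=> K [H [[[|L g1] [g2 [-> Eg]]] PKH]]; first by left; rewrite Eg.
  by right; apply/IH; exists K, H; split=> //; exists g1, g2.
Qed.

Lemma comp_some_consecutive (P : generation n -> generation n -> bool) :
  computable (fun p : generation n * generation n => P p.1 p.2) ->
  computable (some_consecutive P).
Proof.
move=> cP; rewrite /some_consecutive.
computability.
apply: (@comp_comp _ _ _ _ (fun x => (x.2.2, head x.2.2 x.2.1.1)) cP).
by computability.
Qed.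

Lemma comp_pos_part (X : codedType) (f : X -> generation n) :
  computable f -> computable (fun x => int_parts (pos (f x))).
Proof. by move=> cf; apply: comp_comp comp_int_parts (comp_comp (@comp_pos n) cf). Qed.

Lemma comp_magnitude (X : codedType) (f : X -> generation n) :
  computable f -> computable (fun x => magnitude (pos (f x))).
Proof.
by move=> /comp_pos_part cf; rewrite /magnitude; computability.
Qed.

Lemma comp_left_end (X : codedType) (f g h : X -> generation n) :
  computable f -> computable g -> computable h ->
  computable (fun x => left_end (f x) (g x) (h x)).
Proof.
move=> cf cg /comp_pos_part ch; have mf := comp_magnitude cf; have mg := comp_magnitude cg.
by rewrite /left_end /shifted /offset; computability.
Qed.

Lemma comp_in_phase :
  computable (fun p : generation n * generation n => in_phase p.1 p.2).
Proof.
have c := comp_id (generation n * generation n)%type.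
have c1 := comp_fst c; have c2 := comp_snd c.
have cl1 := comp_left_end c1 c2 c1; have cl2 := comp_left_end c1 c2 c2.
by rewrite /in_phase; computability.
Qed.

Lemma comp_cell_at_nat (X : codedType) (p : X -> nat)
    (s : X -> seq (cell n)) (j : X -> nat) :
  computable p -> computable s -> computable j ->
  computable (fun x => cell_at_nat (p x) (s x) (j x)).
Proof. by move=> cp cs cj; rewrite /cell_at_nat; computability. Qed.

Lemma comp_child_in A B C :
  computable (fun p : generation n * generation n => child_in A B C p.1 p.2).
Proof.
have side (X : codedType) (f g : X -> generation n) : computable f -> computable g ->
  [/\ computable (fun x => left_end (f x) (g x) (f x)),
      computable (fun x => left_end (f x) (g x) (g x)),
      computable (fun x => cells (f x)) & computable (fun x => cells (g x))].
  move=> cf cg; split; try exact: comp_left_end.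
    exact: comp_comp (@comp_cells n) cf.
  exact: comp_comp (@comp_cells n) cg.
have c := comp_id (generation n * generation n)%type.
have [p q s t] := side _ _ _ (comp_fst c) (comp_snd c).
have d := comp_id ((generation n * generation n) * nat)%type.
have dj := comp_snd d; have dj1 := comp_S dj; have dj2 := comp_S dj1.
have [dp dq ds dt] := side _ _ _ (comp_fst (comp_fst d)) (comp_snd (comp_fst d)).
have A1 := comp_cell_at_nat dp ds dj; have B1 := comp_cell_at_nat dp ds dj2.
have C1 := comp_cell_at_nat dq dt dj1.
by rewrite /child_in; computability.
Qed.

Definition phased g : bool := ~~ some_consecutive (fun G H => ~~ in_phase G H) g.

Lemma phasedP g :
  phased g <-> forall G H, consecutive g G H -> is_left_pos H (pos G + 1)%R.
Proof.
split=> [/some_consecutiveP ph G H GH|ph].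
  by rewrite -in_phaseE; apply/negPn/negP => nGH; apply: ph; exists G, H.
by apply/some_consecutiveP => -[G [H [/ph]]]; rewrite in_phaseE => ->.
Qed.

Definition occurs A B C g : bool := some_consecutive (child_in A B C) g.

Lemma occurs_child A B C g : occurs A B C g -> child g A B C.
Proof.
case/some_consecutiveP=> G [H [GH /child_in_sound[j [lj AE BE CE]]]].
by exists G, H, j.
Qed.

Lemma child_occurs A B C g :
  child g A B C -> [/\ A = NN, B = NN & C = NN] \/ occurs A B C g.
Proof.
case=> G [H [j [GH lj AE BE CE]]].
case: (child_in_complete lj AE BE CE) => [|ABC]; first by left.
by right; apply/some_consecutiveP; exists G, H.
Qed.

(** The part of the definition of SCA patterns that depends only on which triples
of cells occur. *)
Definition rules_for (R : cell n -> cell n -> cell n -> Prop) : Prop :=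
  [/\ forall A B C, R A B C ->
        left_occupied C = isSome (right_exit A) /\
        right_occupied C = isSome (left_exit B),
      exists tau, forall A B C m, R A B C -> cell_motion C = Some m ->
        m = tau (right_exit A, left_exit B)
    & exists kappa, forall A B C k, R A B C -> cell_kind C = Some k ->
        k = kappa (cell_kind A, cell_kind B)].

(** The empty triple may be added: an empty child satisfies all the conditions,
as its neighbours send no strand. *)
Lemma rules_for_sub (R S : cell n -> cell n -> cell n -> Prop) :
  (forall A B C, S A B C -> [/\ A = NN, B = NN & C = NN] \/ R A B C) ->
  rules_for R -> rules_for S.
Proof.
move=> SR [occ [tau Htau] [kappa Hkappa]]; split.
- by move=> A B C /SR[[-> -> ->] //|/occ].
- by exists tau => A B C m /SR[[-> -> ->] //|]; apply: Htau.
- by exists kappa => A B C m /SR[[-> -> ->] //|]; apply: Hkappa.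
Qed.

Lemma SCA_patternE g : SCA_pattern g <-> phased g /\ rules_for (child g).
Proof.
split=> [[[ph occ] tau kappa]|[/phasedP ph [occ tau kappa]]]; last by [].
by split=> //; apply/phasedP.
Qed.

Lemma SCA_pattern_computable :
  exists2 b : grid_pattern n -> bool, computable b & forall g, b g <-> SCA_pattern g.
Proof.
pose p (t : cell_index n * cell_index n * cell_index n) g :=
  occurs (cell_of_index t.1.1) (cell_of_index t.1.2) (cell_of_index t.2) g.
have [|x y xy|b cb bE] := @decide_finite _ _ p (fun g => rules_for (child g)).
- move=> t; exact/comp_some_consecutive/comp_child_in.
- apply: rules_for_sub => A B C /child_occurs[|]; first by left.
  have [i ->] := cell_of_index_surj A; have [j ->] := cell_of_index_surj B.
  have [k ->] := cell_of_index_surj C.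
  by rewrite -[occurs _ _ _ _]/(p (i, j, k) y) -xy => /occurs_child; right.
exists (fun g => phased g && b g).
  apply: comp_andb => //; apply: comp_negb; apply: comp_some_consecutive.
  exact/comp_negb/comp_in_phase.
move=> g; rewrite SCA_patternE -bE.
by split=> [/andP[]|[-> ->]].
Qed.

End Patterns.

Theorem theorem3p2 (n : nat) (hn : 0 < n) :
  decidable_problem (@code_instance n)
    (fun x : grid_pattern n * word n => SCA_representation x.1 x.2).
Proof.
have [b cb bE] := SCA_pattern_computable n.
pose d (x : grid_pattern n * word n) := b x.1 && decide_braid_eq (psi x.1) x.2.
have [phi rphi phiE] : computable d.
  have c := comp_id (grid_pattern n * word n)%type.
  have c1 := comp_fst c; have c2 := comp_snd c.
  apply: comp_andb; first exact: comp_comp cb c1.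
  apply: (@comp_comp _ _ _ _ (fun x => (psi x.1, x.2)) (comp_decide_braid_eq n)).
  by apply: comp_pair => //; exact: comp_comp (@comp_psi n) c1.
(* the code of a pair is the code of the list of the two entries *)
exists (fun t => phi (CodeSeq.code [:: tnth t (inord 0); tnth t (inord 1)])).
  apply: rec_comp1 rphi _; apply: rec_comp2 rec_code_cons _ _; first exact: recursive_proj.
  by apply: rec_comp2 rec_code_cons _ _; [exact: recursive_proj | exact: rec_const].
have dP x : d x <-> SCA_representation x.1 x.2.
  rewrite /SCA_representation -bE; split=> [/andP[? /decide_braid_eqP] //|].
  by case=> bx /decide_braid_eqP; rewrite /d bx.
move=> x; rewrite !(tnth_nth 0) !inordK //= -[phi _]phiE.
split=> [/dP ->//|nP].
by case: (boolP (d x)) => // /dP.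
Qed.
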